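(* If $S$ is nonempty, then $$\sum_{r\geq0}\dim\mathrm{WH}_r(\mathcal{D}_n(G,S))\,t^r=\prod_{i=0}^{n-1}\bigl(1+(|S|+|G|i)t\bigr).$$
   Context: $G$ is a finite group acting on a finite set $S$, $n\geq1$. A projectivized $G$-coloring of a finite set $B$ is an equivalence class of $b:B\to G$ with $b\sim bg$, $g\in G$. A partial $G$-partition $\tilde\beta$ of $[n]$ is a partition $\beta$ of a subset of $[n]$ into nonempty blocks each with a projectivized $G$-coloring; its zero block is $Z=[n]\setminus\bigcup B$. $\mathcal{D}_n(G,S)$ is the set of pairs $(\tilde\beta,z)$, $z:Z\to S$, ordered by the order generated by: (merge) $(\tilde\beta\cup\{\tilde A,\tilde B\},z)\prec(\tilde\beta\cup\{\tilde C\},z)$ with $C=A\cup B$, $c=a\cup bg$ for representatives $a,b$ and some $g\in G$; (color) $(\tilde\beta\cup\{\tilde B\},z)\prec(\tilde\beta,z')$ where $z'$ extends $z$ to $Z\cup B$ with $z'|_B=f\circ b$ for some $G$-equivariant $f:G\to S$. Rank $\operatorname{rk}(\tilde\beta,z)=n-\ell(\beta)$; $\hat0$ is the all-singletons element. Whitney homology: $\mathrm{WH}_r(\mathcal{D}_n(G,S))=\bigoplus_{x\in\mathcal{D}_n(G,S)}\tilde H_{r-2}(\hat0,x)$, the reduced homology of the order complexes of open intervals $(\hat0,x)$ (with $\tilde H_{-2}(\hat0,\hat0)$ the coefficients by convention), taken with coefficients in a field. *)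

(* Defs.v *)
From HB Require Import structures.
From mathcomp Require Import all_boot all_order all_fingroup all_algebra.

Set Implicit Arguments.
Unset Strict Implicit.
Unset Printing Implicit Defensive.

Import Order.TTheory GRing.Theory.
Local Open Scope ring_scope.

(* Degrees are shifted by one throughout: a simplex with [m] vertices has
   dimension [m - 1], and the empty simplex ([m = 0]) is allowed, so that the
   complex is the augmented one. *)
Section OrderComplexHomology.
Variables (F : fieldType) (disp : Order.disp_t) (T : finPOrderType disp).
Variable A : {set T}.

Definition simplex (m : nat) : Type :=
  {s : m.-tuple T | sorted <%O s && all (mem A) s}.

HB.instance Definition _ m := Finite.on (simplex m).

Definition chain (m : nat) : Type := {ffun simplex m -> F^o}.

HB.instance Definition _ m := Vector.on (chain m).

Definition face (k : nat) (s : seq T) : seq T := take k s ++ drop k.+1 s.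

Definition incidence m (s : simplex m.+1) (t : simplex m) : F :=
  \sum_(k < m.+1 | face k (val s) == val t :> seq T) (-1) ^+ k.

Definition boundary_fun m (c : chain m.+1) : chain m :=
  [ffun t => \sum_s incidence s t * c s].

Fact boundary_fun_is_linear m : linear (@boundary_fun m).
Proof.
move=> a u v; apply/ffunP => t; rewrite !ffunE /GRing.scale /=.
rewrite big_distrr -big_split /=; apply: eq_bigr => s _.
by rewrite !ffunE mulrDr mulrCA.
Qed.

HB.instance Definition _ m :=
  GRing.isLinear.Build F (chain m.+1) (chain m) _ (@boundary_fun m)
    (@boundary_fun_is_linear m).

Definition boundary m : 'Hom(chain m.+1, chain m) := linfun (@boundary_fun m).

Definition cycles (m : nat) : {vspace chain m} :=
  if m is m'.+1 then lker (boundary m') else fullv.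

Definition boundaries (m : nat) : {vspace chain m} := limg (boundary m).

(* [homology m] is the reduced homology in degree [m - 1] of the order complex
   of [A]; the quotient cycles / boundaries is realized as a complement of the
   boundaries in the cycles. *)
Definition homology (m : nat) : {vspace chain m} :=
  (cycles m :\: boundaries m)%VS.

End OrderComplexHomology.

Section WhitneyHomology.
Variables (F : fieldType) (disp : Order.disp_t) (T : finPOrderType disp).

Definition open_interval (x y : T) : {set T} := [set u | (x < u < y)%O].

Definition zero_space : vectType F := 'rV[F]_0.

Definition direct_sum (U V : vectType F) : vectType F := (U * V)%type.

(* The reduced homology of (zero, x) in degree r - 2. The degenerate interval
   (zero, zero) is not treated as an empty complex: its homology is F,
   concentrated in degree -2. For x != zero there is nothing in degree -2. *)
Definition interval_homology (zero x : T) (r : nat) : vectType F :=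
  if x == zero then (if r == 0%N then (F^o : vectType F) else zero_space)
  else if r is m.+1 then subvs_of (homology F (open_interval zero x) m)
  else zero_space.

Definition WH (zero : T) (r : nat) : vectType F :=
  \big[direct_sum/zero_space]_(x : T) interval_homology zero x r.

End WhitneyHomology.

Section Colorings.
Variables (n : nat) (gT : finGroupType).

(* A function on a subset of [n] is a partial function on 'I_n. *)
Definition dom (X : Type) (b : {ffun 'I_n -> option X}) : {set 'I_n} :=
  [set i | isSome (b i)].

(* The union of two partial functions, used for disjoint domains only. *)
Definition glue (X : Type) (a b : {ffun 'I_n -> option X}) :
    {ffun 'I_n -> option X} :=
  [ffun i => if a i is Some u then Some u else b i].

Definition pcomp (X Y : Type) (f : X -> Y) (b : {ffun 'I_n -> option X}) :
    {ffun 'I_n -> option Y} :=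
  [ffun i => omap f (b i)].

Definition coloring : Type := {ffun 'I_n -> option gT}.

HB.instance Definition _ := Finite.on coloring.

Definition shift (b : coloring) (g : gT) : coloring :=
  pcomp (fun u => (u * g)%g) b.

Definition proj_coloring (b : coloring) : {set coloring} :=
  [set shift b g | g : gT].

(* A block together with its projectivized coloring is encoded by the
   equivalence class of colorings alone, as the block is their domain. *)
Definition colored_block (B : {set coloring}) : bool :=
  [exists b : coloring, (dom b != set0) && (B == proj_coloring b)].

Definition block (B : {set coloring}) : {set 'I_n} := \bigcup_(b in B) dom b.

Definition partial_partition (beta : {set {set coloring}}) : bool :=
  [forall B in beta, colored_block B] &&
  [forall A in beta, forall B in beta,
     (A != B) ==> [disjoint block A & block B]].

Definition zero_block (beta : {set {set coloring}}) : {set 'I_n} :=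
  ~: \bigcup_(B in beta) block B.

Definition singleton_coloring (i : 'I_n) : coloring :=
  [ffun j => if j == i then Some 1%g else None].

Definition singletons : {set {set coloring}} :=
  [set proj_coloring (singleton_coloring i) | i : 'I_n].

Lemma dom_pcomp (X Y : Type) (f : X -> Y) (b : {ffun 'I_n -> option X}) :
  dom (pcomp f b) = dom b.
Proof. by apply/setP => i; rewrite !inE ffunE; case: (b i). Qed.

Lemma block_proj_coloring (b : coloring) : block (proj_coloring b) = dom b.
Proof.
apply/setP => i; apply/bigcupP/idP => [[_ /imsetP[g _ ->]]|bi].
  by rewrite dom_pcomp.
by exists (shift b 1%g); [apply: imset_f | rewrite dom_pcomp].
Qed.

Lemma dom_singleton_coloring i : dom (singleton_coloring i) = [set i].
Proof. by apply/setP => j; rewrite !inE ffunE; case: eqP. Qed.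

Lemma partial_partition_singletons : partial_partition singletons.
Proof.
apply/andP; split.
  apply/forall_inP => _ /imsetP[i _ ->]; apply/existsP.
  exists (singleton_coloring i); rewrite eqxx andbT dom_singleton_coloring.
  by apply/set0Pn; exists i; rewrite set11.
apply/forall_inP => _ /imsetP[i _ ->]; apply/forall_inP => _ /imsetP[j _ ->].
apply/implyP => neq_ij; rewrite !block_proj_coloring !dom_singleton_coloring.
by rewrite disjoints1 inE; apply: contraNneq neq_ij => ->.
Qed.

Lemma zero_block_singletons : zero_block singletons = set0.
Proof.
apply/setP => i; rewrite !inE; apply/negbF/bigcupP.
exists (proj_coloring (singleton_coloring i)); first exact: imset_f.
by rewrite block_proj_coloring dom_singleton_coloring set11.
Qed.

End Colorings.

Section DowlingElements.
Variables (n : nat) (gT : finGroupType) (S : finType).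

Definition dowling_pred
    (x : {set {set coloring n gT}} * {ffun 'I_n -> option S}) : bool :=
  partial_partition x.1 && (dom x.2 == zero_block x.1).

Record dowling_elt := DowlingElt {
  dval : {set {set coloring n gT}} * {ffun 'I_n -> option S};
  _ : dowling_pred dval
}.

HB.instance Definition _ := [isSub for dval].
HB.instance Definition _ := [Finite of dowling_elt by <:].

Fact dowling_zero_subproof :
  dowling_pred (singletons n gT, [ffun=> None] : {ffun 'I_n -> option S}).
Proof.
rewrite /dowling_pred /= partial_partition_singletons zero_block_singletons.
by apply/eqP/setP => i; rewrite !inE ffunE.
Qed.

End DowlingElements.

(* The elements do not depend on the action, but their order does. *)
Definition dowling (n : nat) (gT : finGroupType) (S : finType)
  (act : gT -> S -> S) : Type := dowling_elt n gT S.

HB.instance Definition _ n gT S act := Finite.on (@dowling n gT S act).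

Section DowlingPoset.
Variables (n : nat) (gT : finGroupType) (S : finType) (act : gT -> S -> S).

Local Notation D := (dowling n act).

Implicit Types x y : D.

Definition dowling_merge x y : bool :=
  ((dval y).2 == (dval x).2) &&
  [exists a : coloring n gT, exists b : coloring n gT, exists g : gT,
    [&& proj_coloring a \in (dval x).1, proj_coloring b \in (dval x).1,
        proj_coloring a != proj_coloring b &
        (dval y).1 ==
          proj_coloring (glue a (shift b g))
            |: (((dval x).1 :\ proj_coloring a) :\ proj_coloring b)]].

Definition equivariant (f : gT -> S) : bool :=
  [forall h, forall u, f (h * u)%g == act h (f u)].

Definition dowling_color x y : bool :=
  [exists b : coloring n gT, exists f : {ffun gT -> S},
    [&& equivariant f, proj_coloring b \in (dval x).1,
        (dval y).1 == (dval x).1 :\ proj_coloring b &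
        (dval y).2 == glue (dval x).2 (pcomp f b)]].

Definition dowling_cover : rel D := fun x y => dowling_merge x y || dowling_color x y.

Definition dowling_le : rel D := connect dowling_cover.

Lemma card_dowling_cover x y :
  dowling_cover x y -> (#|(dval y).1| < #|(dval x).1|)%N.
Proof.
case/orP => [/andP[_ /existsP[a /existsP[b /existsP[g]]]]|].
  case/and4P => xa xb neq_ab /eqP ->.
  rewrite [X in (_ < X)%N](cardsD1 (proj_coloring a)) xa.
  rewrite (cardsD1 (proj_coloring b) (_ :\ _)) 2!inE eq_sym neq_ab xb.
  by rewrite cardsU1 !add1n !ltnS -add1n leq_add2r leq_b1.
case/existsP => b /existsP[f /and4P[_ xb /eqP -> _]].
by rewrite [X in (_ < X)%N](cardsD1 (proj_coloring b)) xb.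
Qed.

Lemma card_dowling_le x y :
  dowling_le x y -> x = y \/ (#|(dval y).1| < #|(dval x).1|)%N.
Proof.
case/connectP => p; elim: p x => [|u p IHp] x /=; first by move=> _ ->; left.
case/andP => /card_dowling_cover xu /IHp /[apply] -[<-|uy]; right => //.
exact: ltn_trans xu.
Qed.

Fact dowling_le_refl : reflexive dowling_le.
Proof. exact: connect0. Qed.

Fact dowling_le_anti : antisymmetric dowling_le.
Proof.
move=> x y /andP[/card_dowling_le[//|xy] /card_dowling_le[//|yx]].
by have := ltn_trans xy yx; rewrite ltnn.
Qed.

Fact dowling_le_trans : transitive dowling_le.
Proof. exact: connect_trans. Qed.

Fact dowling_display : Order.disp_t. Proof. exact: Order.Disp tt tt. Qed.

HB.instance Definition _ :=
  Order.Le_isPOrder.Build dowling_display D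
    dowling_le_refl dowling_le_anti dowling_le_trans.

Definition dowling_zero : D := DowlingElt (dowling_zero_subproof n gT S).

End DowlingPoset.

(* Main.v *)
From HB Require Import structures.
Require Import Defs.
From mathcomp Require Import all_boot all_order all_fingroup all_algebra.
From mathcomp Require Import zify ring.

Set Implicit Arguments.
Unset Strict Implicit.
Unset Printing Implicit Defensive.

Import Order.TTheory GRing.Theory.
Local Open Scope ring_scope.

(* Let P_i be the set of elements in which all indices >= i are singletons. An
   element x of P_(i+1) outside P_i has an element y of P_i below it, obtained by
   turning i into a singleton, and y is a modular coatom of [0, x]: the meet of w
   with y is again w with i made a singleton. The part of (0, x) whose meet with
   y is nonzero contracts to y; what remains are the atoms a <= x not below y,
   and (a, x) is homotopy equivalent to (0, y). So the homology of (0, x) is that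
   of (0, y), shifted by one degree and repeated once for each such a. A pair
   (x, a) is the same thing as a pair (y, a), because x is the join of y and a,
   and there are |S| + |G| i atoms a that involve i and otherwise only indices
   < i; this gives the factor 1 + (|S| + |G| i) t.

   Contractions are replaced by adding vertices one at a time: if L is the link
   of v in A, the ranks of the boundary maps of A + v are squeezed between sums of
   ranks for A and for L, and equality holds when L is acyclic or when the
   homologies of A and L sit in adjacent degrees. *)

(** * The Koszul complex on a finite poset *)

(** Concentration in a single degree is part of the induction: adding an atom a adds up dimensions
    only if the map from the homology of its link to that of the part already built vanishes, and
    this is read off from the degrees. Two elements of the poset need not have a common upper bound,
    and blocks are only given up to rescaling, so meets and joins are never formed in general.
    Normal forms fix one coloring per block, which turns the order into pointwise equations, and the
    meet with y and the join with a into changes of the value at the single index i. All chain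
    groups are subspaces of one space of functions on subsets of the poset, where complexes on
    different vertex sets can be compared by the operators of the exterior algebra. *)

Section LinearExtension.
Variables (disp : Order.disp_t) (T : finPOrderType disp).

(** The number of smaller elements already respects the order; the factor [#|T|] leaves room for
    [enum_rank] to break ties. Signs need a total order because they are attached to arbitrary
    subsets, not only to chains. *)
Definition lin_ext (u : T) : nat :=
  (#|[set w | (w < u)%O]| * #|T| + enum_rank u)%N.

Lemma lin_ext_inj : injective lin_ext.
Proof.
move=> u w; rewrite /lin_ext => /(congr1 (modn^~ #|T|)).
by rewrite !modnMDl !modn_small // => /val_inj/enum_rank_inj.
Qed.

Lemma lin_ext_lt (u w : T) : (u < w)%O -> (lin_ext u < lin_ext w)%N.
Proof.
move=> uw; rewrite /lin_ext.
have lt_c : (#|[set v | (v < u)%O]| < #|[set v | (v < w)%O]|)%N.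
  apply/proper_card/properP; split.
    by apply/subsetP => v; rewrite !inE => /lt_trans; apply.
  by exists u; rewrite !inE ?uw ?ltxx.
apply: leq_trans (leq_trans (leq_mul lt_c (leqnn #|T|)) (leq_addr _ _)).
by rewrite mulSn addnC ltn_add2r ltn_ord.
Qed.

Lemma lin_ext_ltE (u w : T) :
  (u >=< w)%O -> (lin_ext u < lin_ext w)%N = (u < w)%O.
Proof.
move=> cmp; apply/idP/idP => [|/lin_ext_lt//].
by case: (comparable_ltgtP cmp) => // [/lin_ext_lt|->]; [lia|rewrite ltnn].
Qed.

Lemma lin_ext_total (u w : T) :
  u != w -> (lin_ext u < lin_ext w)%N = ~~ (lin_ext w < lin_ext u)%N.
Proof.
move=> neq_uw; rewrite -leqNgt [RHS]leq_eqVlt (inj_eq lin_ext_inj).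
by rewrite (negbTE neq_uw).
Qed.

End LinearExtension.

Section Koszul.
Variables (F : fieldType) (disp : Order.disp_t) (T : finPOrderType disp).

Local Notation V := {ffun {set T} -> F^o}.
Implicit Types (A B t s : {set T}) (u v w : T) (c : V).

(** The sign of moving [u] to its place among the elements of [t]; [u] itself is never counted, so
    it may or may not belong to [t]. *)
Definition sgn t u : F :=
  (-1) ^+ #|[set w in t | (lin_ext w < lin_ext u)%N]|.

Lemma sgnU1 t u v : u \notin t ->
  sgn (u |: t) v = (-1) ^+ (lin_ext u < lin_ext v)%N * sgn t v.
Proof.
move=> ut; rewrite /sgn -exprD; congr (_ ^+ _).
case: ltnP => uv; last first.
  apply: eq_card => w; rewrite !inE; case: eqP => // ->.
  by rewrite (negbTE ut) ltnNge uv.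
rewrite (cardsD1 u) !inE eqxx uv; congr (_ + _)%N.
apply: eq_card => w; rewrite !inE; case: eqP => //= ->.
by rewrite (negbTE ut).
Qed.

Lemma sgnD1 t u v : u \in t ->
  sgn (t :\ u) v = (-1) ^+ (lin_ext u < lin_ext v)%N * sgn t v.
Proof.
move=> ut; rewrite -{2}(setD1K ut) sgnU1 ?setD11 //.
by rewrite mulrA -signr_addb addbb mul1r.
Qed.

Lemma sgn_sq t u : sgn t u * sgn t u = 1.
Proof. by rewrite -expr2 sqrr_sign. Qed.

(** A function [c] on subsets stands for the element of the exterior algebra on [T] with coefficient
    [c t] on the ordered monomial of [t]. Then [ext_mul v] is left multiplication by [v],
    [contract v] its transpose, and [koszul] the augmented boundary of the full simplex on [T]. *)
Definition ext_mul_fun v c : V :=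
  [ffun t : {set T} => if v \in t then sgn t v * c (t :\ v) else 0].

Definition contract_fun v c : V :=
  [ffun t : {set T} => if v \in t then 0 else sgn t v * c (v |: t)].

Fact ext_mul_is_linear v : linear (ext_mul_fun v).
Proof.
move=> k c c'; apply/ffunP => t; rewrite !ffunE.
by case: ifP => _; rewrite ?scaler0 ?addr0 // /GRing.scale /=; ring.
Qed.

Fact contract_is_linear v : linear (contract_fun v).
Proof.
move=> k c c'; apply/ffunP => t; rewrite !ffunE.
by case: ifP => _; rewrite ?scaler0 ?addr0 // /GRing.scale /=; ring.
Qed.

HB.instance Definition _ v :=
  GRing.isLinear.Build F V V _ (ext_mul_fun v) (ext_mul_is_linear v).
HB.instance Definition _ v :=
  GRing.isLinear.Build F V V _ (contract_fun v) (contract_is_linear v).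

Definition ext_mul v : 'End(V) := linfun (ext_mul_fun v).
Definition contract v : 'End(V) := linfun (contract_fun v).
Definition koszul : 'End(V) := \sum_v contract v.

Lemma ext_mulE v c t :
  ext_mul v c t = if v \in t then sgn t v * c (t :\ v) else 0.
Proof. by rewrite lfunE /= ffunE. Qed.

Lemma contractE v c t :
  contract v c t = if v \in t then 0 else sgn t v * c (v |: t).
Proof. by rewrite lfunE /= ffunE. Qed.

Lemma koszulE c t :
  koszul c t = \sum_(u | u \notin t) sgn t u * c (u |: t).
Proof.
rewrite sum_lfunE sum_ffunE [RHS]big_mkcond /=; apply: eq_bigr => u _.
by rewrite contractE; case: (u \in t).
Qed.

(** The canonical anticommutation relation. For distinct vertices exactly one of the two orders of
    insertion flips a sign, by [lin_ext_total]. *)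
Lemma contract_ext u v c :
  contract u (ext_mul v c) = (if u == v then c else 0) - ext_mul v (contract u c).
Proof.
apply/ffunP => t; rewrite !ffunE contractE !ext_mulE contractE.
case: (eqVneq u v) => [<-|neq_uv].
  rewrite !inE eqxx /=; case: ifP => ut; last first.
    by rewrite mulrA sgnU1 ?ut // ltnn mul1r sgn_sq mul1r setU1K ?ut // subr0.
  by rewrite sgnD1 // ltnn mul1r mulrA sgn_sq mul1r setD1K // subrr.
have neq_vu : v == u = false by rewrite eq_sym (negbTE neq_uv).
rewrite !inE neq_vu (negbTE neq_uv) ffunE /=.
case: ifP => ut; case: ifP => vt; rewrite ?mulr0 ?subr0 //.
have -> : (u |: t) :\ v = u |: (t :\ v).
  by apply/setP => w; rewrite !inE; case: (eqVneq w u) => [->|//]; rewrite neq_uv.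
rewrite sgnU1 ?ut // sgnD1 // sub0r.
by rewrite (lin_ext_total neq_uv); case: ltnP => _ /=; rewrite ?expr0 ?expr1; ring.
Qed.

Lemma contract_contract u v c :
  contract u (contract v c) = if u == v then 0 else - contract v (contract u c).
Proof.
apply/ffunP => t; rewrite contractE contractE.
case: (eqVneq u v) => [<-|neq_uv]; first by rewrite ffunE !inE eqxx mulr0 if_same.
have neq_vu : v == u = false by rewrite eq_sym (negbTE neq_uv).
rewrite ffunE !contractE !inE neq_vu (negbTE neq_uv) /=.
case: ifP => ut; case: ifP => vt; rewrite ?mulr0 ?oppr0 //.
rewrite !sgnU1 ?ut ?vt // setUCA.
by rewrite (lin_ext_total neq_uv); case: ltnP => _ /=; rewrite ?expr0 ?expr1; ring.
Qed.

(** The cone formula: multiplication by [v] is a homotopy between the identity and zero. *)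
Lemma koszul_ext v c : koszul (ext_mul v c) = c - ext_mul v (koszul c).
Proof.
rewrite !sum_lfunE linear_sum /=.
rewrite (eq_bigr _ (fun u _ => contract_ext u v c)) sumrB; congr (_ - _).
by rewrite -big_mkcond big_pred1_eq.
Qed.

(** The terms (u, v) and (v, u) cancel. They are separated by [lin_ext] before being paired, because
    in characteristic 2 a sum equal to its own opposite need not be zero. *)
Lemma koszul_koszul c : koszul (koszul c) = 0.
Proof.
have -> : koszul (koszul c) = \sum_u \sum_v contract u (contract v c).
  by rewrite sum_lfunE; apply: eq_bigr => u _; rewrite sum_lfunE linear_sum.
have split_uv u : \sum_v contract u (contract v c) =
    \sum_(v | (lin_ext u < lin_ext v)%N) contract u (contract v c)
    + \sum_(v | (lin_ext v < lin_ext u)%N) contract u (contract v c).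
  rewrite (bigID (fun v => (lin_ext u < lin_ext v)%N)) /=; congr (_ + _).
  rewrite (bigD1 u) ?ltnn //= contract_contract eqxx add0r; apply: eq_bigl => v.
  rewrite -leqNgt [RHS]ltn_neqAle andbC; congr (_ && _).
  by rewrite (inj_eq (@lin_ext_inj _ _)).
rewrite (eq_bigr _ (fun u _ => split_uv u)) big_split /=.
rewrite (exchange_big_dep xpredT) //= -big_split big1 // => v _ /=.
rewrite -big_split big1 // => u ltuv /=; rewrite contract_contract ifN ?addNr //.
by apply: contraTneq ltuv => ->; rewrite ltnn.
Qed.

End Koszul.

(** * Homology of order complexes: adding a vertex *)

Section ChainSpaces.
Variables (F : fieldType) (disp : Order.disp_t) (T : finPOrderType disp).

Local Notation V := {ffun {set T} -> F^o}.
Local Notation koszul := (koszul F T).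
Local Notation ext_mul := (@ext_mul F disp T).
Local Notation contract := (@contract F disp T).
Implicit Types (A B L t s : {set T}) (u v w : T) (c p q : V) (m k : nat).

Definition chain_sets A m : {set {set T}} :=
  [set s : {set T} | [&& s \subset A, #|s| == m &
    [forall u in s, forall w in s, (u >=< w)%O]]].

Lemma chain_setsP A m s :
  reflect [/\ {subset s <= A}, #|s| = m & {in s &, forall u w, (u >=< w)%O}]
          (s \in chain_sets A m).
Proof.
rewrite inE; apply: (iffP and3P) => [[/subsetP sA /eqP sm /forall_inP cmp]|].
  by split=> // u w us ws; apply: (forall_inP (cmp u us)).
case=> sA sm cmp; split; [exact/subsetP|exact/eqP|].
by apply/forall_inP => u us; apply/forall_inP => w; apply: cmp.
Qed.

(** Forgetting the coefficients on [K] is linear, with the functions supported on [K] as kernel;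
    [chains] is obtained in this way. *)
Definition off_fun (K : {set {set T}}) c : V :=
  [ffun t : {set T} => if t \in K then 0 else c t].

Fact off_is_linear K : linear (off_fun K).
Proof.
move=> k c c'; apply/ffunP => t; rewrite !ffunE.
by case: ifP => _; rewrite ?scaler0 ?addr0.
Qed.

HB.instance Definition _ K :=
  GRing.isLinear.Build F V V _ (off_fun K) (off_is_linear K).

Definition chains A m : {vspace V} := lker (linfun (off_fun (chain_sets A m))).

Lemma chainsP A m c :
  reflect (forall t, t \notin chain_sets A m -> c t = 0) (c \in chains A m).
Proof.
rewrite memv_ker lfunE /=; apply: (iffP eqP) => [c0 t tK | c0].
  by move/ffunP/(_ t): c0; rewrite !ffunE (negbTE tK).
by apply/ffunP => t; rewrite !ffunE; case: ifPn => // /c0.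
Qed.

Lemma chainsS A B m : A \subset B -> (chains A m <= chains B m)%VS.
Proof.
move=> sAB; apply/subvP => c /chainsP c0; apply/chainsP => t tB; apply: c0.
apply: contra tB => /chain_setsP[tA tm cmp]; apply/chain_setsP; split=> // u /tA.
exact: subsetP.
Qed.

Lemma koszul_chains A m c : c \in chains A m.+1 -> koszul c \in chains A m.
Proof.
move=> /chainsP c0; apply/chainsP => t tA; rewrite koszulE big1 // => u ut.
rewrite c0 ?mulr0 //; apply: contra tA => /chain_setsP[uA um cmp].
apply/chain_setsP; split.
- by move=> w wt; rewrite uA // setU1r.
- by move: um; rewrite cardsU1 ut add1n => -[].
- by move=> w w' wt wt'; apply: cmp; apply: setU1r.
Qed.

Lemma koszul_chains0 A c : c \in chains A 0 -> koszul c = 0.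
Proof.
move=> /chainsP c0; apply/ffunP => t; rewrite koszulE big1 ?ffunE // => u ut.
rewrite c0 ?mulr0 //; apply/negP => /chain_setsP[_ /eqP].
by rewrite cardsU1 ut.
Qed.

Lemma ext_chains A B v m c : A \subset B -> v \in B ->
  {in A, forall w, (w >=< v)%O} -> c \in chains A m -> ext_mul v c \in chains B m.+1.
Proof.
move=> sAB vB Av /chainsP c0; apply/chainsP => t tB; rewrite ext_mulE.
case: ifP => // vt; rewrite c0 ?mulr0 //; apply: contra tB.
case/chain_setsP => tA tm cmp; rewrite -(setD1K vt); apply/chain_setsP; split.
- by move=> w /setU1P[->//|/tA]; apply: subsetP.
- by rewrite cardsU1 setD11 tm.
- move=> u w /setU1P[->|ut] /setU1P[->|wt]; rewrite ?comparablexx //.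
  + by rewrite comparable_sym Av ?tA.
  + by rewrite Av ?tA.
  + exact: cmp.
Qed.

Lemma contract_chains0 A v m c : v \notin A -> c \in chains A m -> contract v c = 0.
Proof.
move=> vA /chainsP c0; apply/ffunP => t; rewrite contractE ffunE.
case: ifP => // vt; rewrite c0 ?mulr0 //; apply/negP => /chain_setsP[tA _ _].
by move/negP: vA; apply; apply: tA; apply: setU11.
Qed.

(** This is the rank of the boundary leaving degree [m]; the one arriving there has index [m.+1]. By
    [rk_le], the subtractions in [homology_dim] are never truncated. *)
Definition boundary_rank A m : nat := \dim (koszul @: chains A m).
Definition homology_dim A m : nat := (\dim (chains A m) - boundary_rank A m - boundary_rank A m.+1)%N.

Lemma rk0 A : boundary_rank A 0 = 0%N.
Proof.
apply/eqP; rewrite dimv_eq0 -subv0; apply/subvP => _ /memv_imgP[c cA ->].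
by rewrite (koszul_chains0 cA) mem0v.
Qed.

Lemma koszul_boundary_cycle A m :
  (koszul @: chains A m.+1 <= chains A m :&: lker koszul)%VS.
Proof.
apply/subvP => _ /memv_imgP[c cA ->].
by rewrite memv_cap koszul_chains //= memv_ker koszul_koszul.
Qed.

Lemma rk_le A m : (boundary_rank A m + boundary_rank A m.+1 <= \dim (chains A m))%N.
Proof.
rewrite -(limg_ker_dim koszul (chains A m)) addnC leq_add2r.
exact/dimvS/koszul_boundary_cycle.
Qed.

(** Every cycle [c] is the boundary of [ext_mul v c], which still lives on chains of [A] because [v]
    is comparable with all of [A]. *)
Lemma hdim_cone A v m : v \in A -> {in A, forall w, (w >=< v)%O} -> homology_dim A m = 0%N.
Proof.
move=> vA Av; suff: (\dim (chains A m) <= boundary_rank A m + boundary_rank A m.+1)%N.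
  by rewrite /homology_dim -subnDA -subn_eq0 => /eqP.
rewrite -(limg_ker_dim koszul (chains A m)) addnC leq_add2l; apply/dimvS/subvP => c.
rewrite memv_cap memv_ker => /andP[cA /eqP c0].
suff -> : c = koszul (ext_mul v c) by apply/memv_img/(@ext_chains A).
by rewrite koszul_ext c0 linear0 subr0.
Qed.

Section AddVertex.
Variables (A : {set T}) (v : T).
Hypothesis vA : v \notin A.

Let A' := v |: A.
Let L := [set w in A | (w >=< v)%O].

Let vL : v \notin L. Proof. by rewrite inE (negbTE vA). Qed.
Let sLA : L \subset A. Proof. by apply/subsetP => w; rewrite inE => /andP[]. Qed.
Let sAA' : A \subset A'. Proof. exact: subsetU1. Qed.
Let vA' : v \in A'. Proof. exact: setU11. Qed.
Let Lv : {in L, forall w, (w >=< v)%O}.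
Proof. by move=> w; rewrite inE => /andP[]. Qed.

Let ext_L m q : q \in chains L m -> ext_mul v q \in chains A' m.+1.
Proof. by apply: ext_chains => //; apply: subset_trans sAA'. Qed.

Let contract_A' m c : c \in chains A' m.+1 -> contract v c \in chains L m.
Proof.
move=> /chainsP c0; apply/chainsP => t tL; rewrite contractE.
case: ifPn => // vt; rewrite c0 ?mulr0 //; apply: contra tL.
case/chain_setsP => tA tm cmp; apply/chain_setsP; split.
- move=> w wt; rewrite inE cmp ?setU11 ?setU1r // andbT.
  have /setU1P[wv|//] := tA w (setU1r v wt).
  by move: wt vt; rewrite wv => ->.
- by move: tm; rewrite cardsU1 vt add1n => -[].
- by move=> u w ut wt; apply: cmp; apply: setU1r.
Qed.

Let chains_off m c : c \in chains A' m -> contract v c = 0 -> c \in chains A m.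
Proof.
move=> /chainsP c0 /ffunP cv; apply/chainsP => t tA.
have [vt|vt] := boolP (v \in t).
  have := cv (t :\ v); rewrite contractE ffunE setD11 setD1K // => /eqP.
  by rewrite mulf_eq0 signr_eq0 => /eqP.
apply: c0; apply: contra tA => /chain_setsP[tA tm cmp]; apply/chain_setsP; split=> //.
move=> w wt; have /setU1P[wv|//] := tA w wt; by move: wt vt; rewrite wv => ->.
Qed.

Let contract_ext_L m q : q \in chains L m -> contract v (ext_mul v q) = q.
Proof.
move=> qL; rewrite contract_ext eqxx (contract_chains0 vL qL) linear0.
exact: subr0.
Qed.

Let chains_split m c : c \in chains A' m.+1 ->
  exists p q, [/\ p \in chains A m.+1, q \in chains L m & c = p + ext_mul v q].
Proof.
move=> cA; have qL := contract_A' cA.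
exists (c - ext_mul v (contract v c)), (contract v c); split=> //; last by rewrite subrK.
apply: chains_off; first by rewrite rpredB // ext_L.
by rewrite linearB /= (contract_ext_L qL) subrr.
Qed.

Lemma dim_chains_add m :
  (\dim (chains A' m.+1) = \dim (chains A m.+1) + \dim (chains L m))%N.
Proof.
rewrite -(limg_ker_dim (contract v) (chains A' m.+1)); congr addn; congr (\dim _); apply/vspaceP => c.
  rewrite memv_cap memv_ker; apply/andP/idP => [[cA /eqP]|cA]; first exact: chains_off.
  by rewrite (contract_chains0 vA cA) (subvP (chainsS _ sAA')).
apply/idP/idP => [/memv_imgP[c' cA ->]|cL]; first exact: contract_A'.
by rewrite -(contract_ext_L cL) memv_img // ext_L.
Qed.

Lemma dim_chains_add0 : \dim (chains A' 0) = \dim (chains A 0).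
Proof.
congr (\dim _); apply/vspaceP => c; apply/idP/idP => cA.
  apply: chains_off => //; apply/ffunP => t; rewrite contractE ffunE.
  case: ifPn => // vt; move/chainsP: cA => ->; rewrite ?mulr0 //.
  by apply/negP => /chain_setsP[_ /eqP]; rewrite cardsU1 vt.
exact: (subvP (chainsS _ sAA')).
Qed.

(** Contraction by [v] kills the boundaries coming from [A] and sends the boundary of [ext_mul v q]
    to minus that of [q]; apply rank-nullity to it on the boundaries of [A']. *)
Lemma rk_add_ge m : (boundary_rank A m.+1 + boundary_rank L m <= boundary_rank A' m.+1)%N.
Proof.
rewrite [X in (_ <= X)%N]/boundary_rank -(limg_ker_dim (contract v) (koszul @: chains A' m.+1)); apply: leq_add.
  apply/dimvS/subvP => _ /memv_imgP[c cA ->]; rewrite memv_cap memv_ker.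
  rewrite (contract_chains0 vA (koszul_chains cA)) eqxx andbT.
  exact/memv_img/(subvP (chainsS _ sAA')).
apply/dimvS/subvP => _ /memv_imgP[q qL ->].
have Dq0 : contract v (koszul q) = 0.
  case: m qL => [/koszul_chains0 ->|m qL]; first exact: linear0.
  exact: contract_chains0 (koszul_chains qL).
have -> : koszul q = - contract v (koszul (ext_mul v q)).
  rewrite koszul_ext linearB /= contract_ext eqxx Dq0 (contract_chains0 vL qL).
  by rewrite linear0 subr0 sub0r opprK.
by rewrite rpredN; apply/memv_img/memv_img/ext_L.
Qed.

(** Modulo boundaries of [A], the boundary of [ext_mul v q] depends only on [q] modulo boundaries of
    [L], since [koszul (ext_mul v (koszul b)) = koszul b]. This bound exceeds the one of [rk_add_ge]
    by exactly [homology_dim L m]. *)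
Lemma rk_add_le m : (boundary_rank A' m.+1 <= boundary_rank A m.+1 + (\dim (chains L m) - boundary_rank L m.+1))%N.
Proof.
set B := (koszul @: chains L m.+1)%VS.
have sBL : (B <= chains L m)%VS.
  exact: subv_trans (koszul_boundary_cycle _ _) (capvSl _ _).
have dimW : \dim (chains L m :\: B) = (\dim (chains L m) - boundary_rank L m.+1)%N.
  have := dimv_cap_compl (chains L m) B.
  by rewrite (capv_idPr sBL) => <-; rewrite addKn.
pose W := ((koszul \o ext_mul v) @: (chains L m :\: B))%VS.
have : (koszul @: chains A' m.+1 <= koszul @: chains A m.+1 + W)%VS.
  apply/subvP => _ /memv_imgP[c /chains_split[p [q [pA qL ->]]] ->].
  move: qL; rewrite -(addv_diff_cap (chains L m) B) => /memv_addP[w wW [b]].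
  rewrite memv_cap => /andP[_ /memv_imgP[b' bL ->]] ->.
  rewrite !linearD /= addrCA addrC; apply: memv_add; last first.
    by rewrite -comp_lfunE memv_img.
  rewrite koszul_ext koszul_koszul linear0 subr0 -linearD.
  by apply/memv_img/rpredD => //; apply: (subvP (chainsS _ sLA)).
move/dimvS => le_dim; apply: leq_trans le_dim (leq_trans (dimv_add_leqif _ _) _).
by rewrite leq_add2l -dimW -(limg_ker_dim (koszul \o ext_mul v) (_ :\: _)) leq_addl.
Qed.

Lemma hdim_add_acyclic m : (forall k, homology_dim L k = 0%N) -> homology_dim A' m = homology_dim A m.
Proof.
move=> L0; have rk_add k : boundary_rank A' k.+1 = (boundary_rank A k.+1 + boundary_rank L k)%N.
  have := L0 k; rewrite /homology_dim; have := rk_add_ge k; have := rk_add_le k.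
  have := rk_le L k; lia.
case: m => [|m]; rewrite /homology_dim; last first.
  have := L0 m; rewrite /homology_dim; have := rk_le L m; rewrite dim_chains_add !rk_add; lia.
have := rk_add 0%N; rewrite !rk0 dim_chains_add0; lia.
Qed.

(** In the long exact sequence, the map from the homology of [L] to that of [A] vanishes everywhere:
    its source is zero outside degree [d], its target is zero in degree [d]. *)
Lemma hdim_add_concentrated d :
    (forall m, m != d.+1 -> homology_dim A m = 0%N) -> (forall m, m != d -> homology_dim L m = 0%N) ->
  homology_dim A' 0 = 0%N /\ forall m, homology_dim A' m.+1 = (homology_dim A m.+1 + homology_dim L m)%N.
Proof.
move=> A0 L0; have rk_add k : boundary_rank A' k.+1 = (boundary_rank A k.+1 + boundary_rank L k)%N.
  have := rk_add_ge k; have := rk_add_le k; have := rk_le L k.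
  have [-> {k}|kd] := eqVneq k d; last by have := L0 k kd; rewrite /homology_dim; lia.
  (* In degree [d] the bound [rk_add_le] may be too weak; [rk_le A' d] replaces it, using that [A]
     is exact in degree [d] and [L] in the degree just below. *)
  have := A0 d (negbT (ltn_eqF (ltnSn d))); have := rk_le A' d; rewrite /homology_dim.
  case: d {A0} L0 => [|d] L0; first by rewrite !rk0 dim_chains_add0; lia.
  have := L0 d (negbT (ltn_eqF (ltnSn d))); rewrite dim_chains_add /homology_dim.
  have := rk_add_ge d; have := rk_le A d.+1; have := rk_le L d; lia.
split=> [|m]; rewrite /homology_dim.
  have := A0 0%N isT; have := rk_add 0%N; rewrite /homology_dim !rk0 dim_chains_add0; lia.
by have := rk_le A m.+1; have := rk_le L m; rewrite dim_chains_add !rk_add; lia.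
Qed.

End AddVertex.
End ChainSpaces.

(** * Comparison with the simplicial definition *)

Section HomologyDimension.
Variables (F : fieldType) (disp : Order.disp_t) (T : finPOrderType disp).
Variable A : {set T}.

Local Notation V := {ffun {set T} -> F^o}.
Local Notation koszul := (koszul F T).

Definition vertices m (s : simplex A m) : {set T} := [set u in (val s : seq T)].

Lemma simplex_sorted m (s : simplex A m) : sorted <%O (val s : seq T).
Proof. by case/andP: (valP s). Qed.

Lemma simplex_uniq m (s : simplex A m) : uniq (val s : seq T).
Proof. exact: lt_sorted_uniq (simplex_sorted s). Qed.

Lemma vertices_chain m (s : simplex A m) : vertices s \in chain_sets A m.
Proof.
apply/chain_setsP; split.
- by move=> u; rewrite inE => us; have /andP[_ /allP] := valP s; apply.
- by rewrite cardsE; have /card_uniqP -> := simplex_uniq s; rewrite size_tuple.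
- move=> u w; rewrite !inE => us ws.
  have /lt_sorted_leq_nth mono := simplex_sorted s.
  have in_s x : x \in (val s : seq T) -> index x (val s) \in gtn (size (val s)).
    by rewrite -index_mem.
  rewrite -(nth_index u us) -(nth_index u ws) /Order.comparable.
  by rewrite !mono ?in_s //; apply: leq_total.
Qed.

Lemma vertices_inj m : injective (@vertices m).
Proof.
move=> s s' /setP eq_ss'; apply/val_inj/val_inj.
apply: (lt_sorted_eq (simplex_sorted s) (simplex_sorted s')) => u.
by have := eq_ss' u; rewrite !inE.
Qed.

(** A chain becomes a simplex by sorting it along [lin_ext], which agrees with the order on
    comparable elements. *)
Lemma vertices_onto m t : t \in chain_sets A m -> exists s : simplex A m, vertices s = t.
Proof.
case/chain_setsP => tA tm cmp.
pose r := relpre (@lin_ext _ T) leq; pose s := sort r (enum t).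
have mem_s : s =i t by move=> u; rewrite mem_sort mem_enum.
have size_s : size s == m by rewrite size_sort -cardE tm.
have r_total : total r by move=> ? ?; apply: leq_total.
have s_sorted : sorted <%O s.
  have: sorted ltn [seq lin_ext u | u <- s].
    rewrite ltn_sorted_uniq_leq map_inj_uniq ?sort_uniq ?enum_uniq /=; last exact: lin_ext_inj.
    by rewrite sorted_map sort_sorted.
  rewrite sorted_map; apply: (@sub_in_sorted _ (mem t)) => [u w ut wt|].
    by rewrite /= lin_ext_ltE ?cmp.
  by apply/allP => u; rewrite mem_s.
have sP : sorted <%O (Tuple size_s) && all (mem A) (Tuple size_s).
  by rewrite s_sorted; apply/allP => u /=; rewrite mem_s => /tA.
exists (Sub (Tuple size_s) sP); apply/setP => u.
by rewrite inE SubK mem_s.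
Qed.

(** On [chains F A m] this is an isomorphism onto the chains of the simplicial definition, and it
    intertwines the two boundaries ([boundary_restrict]). *)
Definition restrict_fun m (c : V) : chain F A m := [ffun s => c (vertices s)].

Fact restrict_is_linear m : linear (@restrict_fun m).
Proof. by move=> k c c'; apply/ffunP => s; rewrite !ffunE. Qed.

HB.instance Definition _ m :=
  GRing.isLinear.Build F V (chain F A m) _ (@restrict_fun m) (@restrict_is_linear m).

Definition restrict m : 'Hom(V, chain F A m) := linfun (@restrict_fun m).

Lemma restrictE m c s : restrict m c s = c (vertices s).
Proof. by rewrite lfunE /= ffunE. Qed.

Lemma restrict_onto m : (restrict m @: chains F A m)%VS = fullv.
Proof.
apply/vspaceP => c; apply/idP/idP => _; first exact: memvf.
apply/memv_imgP.
pose e : V := [ffun t => \sum_(s : simplex A m | vertices s == t) c s].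
exists e; last first.
  apply/ffunP => s; rewrite restrictE ffunE (eq_bigl (pred1 s)) ?big_pred1_eq // => s'.
  by rewrite (inj_eq (@vertices_inj m)).
apply/chainsP => t tA; rewrite ffunE big_pred0 // => s.
by apply: contraNF tA => /eqP <-; apply: vertices_chain.
Qed.

Lemma restrict_inj m c : c \in chains F A m -> restrict m c = 0 -> c = 0.
Proof.
move=> /chainsP c0 /ffunP rc0; apply/ffunP => t; rewrite ffunE.
have [/vertices_onto[s <-]|/c0//] := boolP (t \in chain_sets A m).
by have := rc0 s; rewrite restrictE ffunE.
Qed.

Lemma dim_restrict m (U : {vspace V}) :
  (U <= chains F A m)%VS -> \dim (restrict m @: U) = \dim U.
Proof.
move=> sU; apply: limg_dim_eq; apply/eqP; rewrite -subv0; apply/subvP => c.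
rewrite memv_cap memv_ker memv0 => /andP[cU /eqP rc0].
by rewrite (restrict_inj (subvP sU c cU) rc0).
Qed.

Lemma face_vertices m (s : simplex A m.+1) (t : simplex A m) (k : 'I_m.+1) :
  (face k (val s) == val t :> seq T) = (vertices t == vertices s :\ tnth (val s) k).
Proof.
set u := tnth _ k; have k_lt : (k < size (val s))%N by rewrite size_tuple.
have [s1 [s2 [s_split def_face]]] : exists s1 s2,
    (val s : seq T) = s1 ++ u :: s2 /\ face k (val s) = s1 ++ s2.
  exists (take k (val s)), (drop k.+1 (val s)); split=> //.
  by rewrite /u (tnth_nth u) -drop_nth // cat_take_drop.
have mem_face : face k (val s) =i vertices s :\ u.
  have [us _] : u \notin s1 ++ s2 /\ uniq (s1 ++ s2).
    by apply/andP; have := simplex_uniq s; rewrite s_split -cat1s uniq_catCA.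
  move=> w; rewrite def_face 3!inE s_split !mem_cat in_cons in us *.
  by case: (eqVneq w u) => [->|//]; apply: negbTE.
apply/eqP/eqP => [face_t|t_face].
  by apply/setP => w; rewrite -mem_face face_t inE.
apply: lt_sorted_eq => [||w]; last by rewrite mem_face -t_face inE.
  apply: subseq_sorted (simplex_sorted s); first exact: lt_trans.
  rewrite def_face s_split cat_subseq //; exact: subseq_cons.
exact: simplex_sorted.
Qed.

(** In a sorted simplex exactly [k] vertices come before position [k], so the exterior sign is the
    usual alternating one. *)
Lemma sgn_vertices m (s : simplex A m.+1) (k : 'I_m.+1) :
  sgn F (vertices s :\ tnth (val s) k) (tnth (val s) k) = (-1) ^+ k.
Proof.
have k_lt : (k < size (val s))%N by rewrite size_tuple.
set u := tnth _ k; have us : u \in vertices s by rewrite inE mem_tnth.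
rewrite sgnD1 // ltnn mul1r /sgn; congr (_ ^+ _).
transitivity #|take k (val s)|; last first.
  have /card_uniqP -> := take_uniq k (simplex_uniq s).
  by rewrite size_take_min (minn_idPl (ltnW k_lt)).
apply: eq_card => w; rewrite !inE.
have [ws|ws] := boolP (w \in (val s : seq T)); last first.
  by apply/esym/negbTE; apply: contra ws; apply: mem_take.
rewrite (in_take_leq _ (ltnW k_lt)) /= /u (tnth_nth w) -{1}(nth_index w ws).
have cmp := (@lin_ext_ltE _ T).
have /chain_setsP[_ _ s_cmp] := vertices_chain s.
rewrite cmp ?s_cmp ?inE ?nth_index ?mem_nth //.
rewrite -{1}(nth_index w ws) (lt_sorted_ltn_nth _ (simplex_sorted s)) //.
by rewrite inE index_mem.
Qed.

(** The sum over positions is reindexed by the deleted vertex, the form in which [koszul] is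
    written. *)
Lemma incidenceE m (s : simplex A m.+1) (t : simplex A m) :
  incidence F s t = \sum_(u | (u \notin vertices t) && (u |: vertices t == vertices s))
                      sgn F (vertices t) u.
Proof.
have cond_s u : (u \notin vertices t) && (u |: vertices t == vertices s) =
    (u \in vertices s) && (vertices t == vertices s :\ u).
  apply/andP/andP => [[ut /eqP <-]|[us /eqP ->]].
    by rewrite setU11 setU1K.
  by rewrite setD11 setD1K.
rewrite (eq_bigl _ _ cond_s).
rewrite (reindex_onto (fun k : 'I_m.+1 => tnth (val s) k)
  (fun u => inord (index u (val s)))) /=; last first.
  move=> u /andP[us _]; rewrite inE in us; rewrite (tnth_nth u) inordK ?nth_index //.
  by rewrite -[X in (_ < X)%N](size_tuple (val s)) index_mem.
apply: eq_big => k.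
  rewrite face_vertices inE mem_tnth /= (tnth_nth (tnth (val s) k)).
  rewrite index_uniq ?size_tuple ?simplex_uniq //.
  by rewrite (_ : inord k = k) ?eqxx ?andbT //; apply/val_inj; rewrite /= inordK.
by rewrite face_vertices => /eqP ->; rewrite sgn_vertices.
Qed.

Lemma boundary_restrict m c : c \in chains F A m.+1 ->
  boundary F A m (restrict m.+1 c) = restrict m (koszul c).
Proof.
move=> cA; apply/ffunP => t; rewrite restrictE lfunE /= ffunE koszulE.
under eq_bigr => s _ do rewrite restrictE incidenceE big_distrl /=.
rewrite (exchange_big_dep (fun u => u \notin vertices t)) /=; last by move=> s u _ /andP[].
apply: eq_bigr => u ut; rewrite -big_distrr /=; congr (_ * _).
have [/vertices_onto[s s_u]|out] := boolP (u |: vertices t \in chain_sets A m.+1).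
  rewrite (eq_bigl (pred1 s)) ?big_pred1_eq ?s_u // => s'.
  by rewrite ut -s_u eq_sym (inj_eq (@vertices_inj _)).
move/chainsP: cA => ->; rewrite // big_pred0 // => s.
by apply: contraNF out => /andP[_ /eqP ->]; apply: vertices_chain.
Qed.

Lemma dim_boundaries m : \dim (boundaries F A m) = boundary_rank F A m.+1.
Proof.
rewrite /boundaries -(restrict_onto m.+1) -limg_comp.
have -> : ((boundary F A m \o restrict m.+1) @: chains F A m.+1 =
    restrict m @: (koszul @: chains F A m.+1))%VS.
  apply/vspaceP => c; rewrite -limg_comp.
  apply/memv_imgP/memv_imgP => -[e eA ->]; exists e => //;
    by rewrite !comp_lfunE boundary_restrict.
rewrite dim_restrict //.
exact: subv_trans (koszul_boundary_cycle _ _ _) (capvSl _ _).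
Qed.

Lemma dim_chain m : \dim {: chain F A m} = \dim (chains F A m).
Proof. by rewrite -(restrict_onto m) dim_restrict. Qed.

Lemma dim_cycles m : \dim (cycles F A m) = (\dim (chains F A m) - boundary_rank F A m)%N.
Proof.
case: m => [|m] /=; first by rewrite rk0 subn0 dim_chain.
have := limg_ker_dim (boundary F A m) fullv.
by rewrite capfv dim_chain -/(boundaries F A m) dim_boundaries => <-; rewrite addnK.
Qed.

Lemma boundaries_cycles m : (boundaries F A m <= cycles F A m)%VS.
Proof.
apply/subvP => _ /memv_imgP[c _ ->]; case: m c => [|m] c /=; first exact: memvf.
have : c \in (restrict m.+2 @: chains F A m.+2)%VS by rewrite restrict_onto memvf.
case/memv_imgP => e eA ->; rewrite memv_ker boundary_restrict //.
by rewrite boundary_restrict ?koszul_chains // koszul_koszul linear0.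
Qed.

Lemma dim_homology m : \dim (homology F A m) = homology_dim F A m.
Proof.
have := dimv_cap_compl (cycles F A m) (boundaries F A m).
rewrite (capv_idPr (boundaries_cycles m)) dim_boundaries dim_cycles /homology_dim.
by move=> <-; rewrite addKn.
Qed.

End HomologyDimension.

(** * Modular coatoms *)

Section PosetTopology.
Variables (F : fieldType) (disp : Order.disp_t) (T : finPOrderType disp).
Implicit Types (A B : {set T}) (u v w a o x y : T).
Local Notation hdim := (homology_dim F).

(** The augmented complex consists of the empty simplex alone, whose indicator is [e]. *)
Lemma hdim_set0 m : hdim (set0 : {set T}) m = (m == 0%N).
Proof.
have rk_0 k : boundary_rank F (set0 : {set T}) k = 0%N.
  case: k => [|k]; first exact: rk0.
  apply/eqP; rewrite -leqn0 -[X in (_ <= X)%N](rk0 F (set0 : {set T})).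
  rewrite rk0; apply: leq_trans (_ : \dim (chains F (set0 : {set T}) k.+1) <= 0)%N.
    by rewrite -(limg_ker_dim (koszul F T) (chains F _ k.+1)) leq_addl.
  rewrite leqn0 dimv_eq0 -subv0; apply/subvP => c /chainsP c0; rewrite memv0.
  apply/eqP/ffunP => t; rewrite ffunE c0 //; apply/negP => /chain_setsP[t0].
  by case: (set_0Vmem t) => [->|[u /t0]]; rewrite ?cards0 ?inE.
rewrite /homology_dim !rk_0 !subn0.
pose e : {ffun {set T} -> F^o} := [ffun t => (t == set0)%:R].
case: m => [|m].
  have -> : chains F (set0 : {set T}) 0 = <[e]>%VS.
    apply/vspaceP => c; apply/idP/vlineP => [/chainsP c0|[k ->]].
      exists (c set0); apply/ffunP => t; rewrite !ffunE /GRing.scale /=.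
      case: eqP => [->|/eqP t0]; first by rewrite mulr1.
      rewrite mulr0 c0 //; apply: contra t0 => /chain_setsP[_ /eqP].
      by rewrite cards_eq0.
    apply/chainsP => t t0; rewrite !ffunE; case: eqP => [t_0|_]; last exact: scaler0.
    case/negP: t0; apply/chain_setsP; split; rewrite t_0 ?cards0 // => u;
      by rewrite inE.
  rewrite dim_vline; case: eqP => // /ffunP/(_ set0)/eqP.
  by rewrite !ffunE eqxx oner_eq0.
apply/eqP; rewrite dimv_eq0 -subv0; apply/subvP => c /chainsP c0; rewrite memv0.
apply/eqP/ffunP => t; rewrite ffunE c0 //; apply/negP => /chain_setsP[t0].
by case: (set_0Vmem t) => [->|[u /t0]]; rewrite ?cards0 ?inE.
Qed.

(* The elements of [B] are added to [A] by increasing values of [f], each one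
   along a link that is a cone. *)
Lemma hdim_add_cones A B (f : T -> nat) m :
    [disjoint A & B] -> (forall u w, (u < w)%O -> f u != f w) ->
    (forall w, w \in B -> exists c, let lk u :=
       [&& u \in A :|: B, (u >=< w)%O, u != w & (u \in B) ==> (f u < f w)%N] in
       lk c /\ forall u, lk u -> (u >=< c)%O) ->
  hdim (A :|: B) m = hdim A m.
Proof.
move=> dAB f_lt; elim: {B}_.+1 {-2}B (ltnSn #|B|) dAB => // k IHk B B_k dAB cones.
have [->|[b Bb]] := set_0Vmem B; first by rewrite setU0.
(* The vertex added last has the largest [f], so that its link is the cone of the hypothesis. *)
case: (arg_maxnP f Bb) => w wB wmax {b Bb}; have Bw : w \in B := wB.
have w_max u : u \in B -> (f u <= f w)%N := wmax u.
have Aw : w \notin A by rewrite (disjointFl dAB Bw).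
have f_w u : u \in B -> (u >=< w)%O -> u != w -> (f u < f w)%N.
  move=> Bu cmp neq; rewrite ltn_neqAle (w_max u Bu) andbT.
  case: (comparable_ltgtP cmp) neq => [uw|wu|->]; rewrite ?eqxx // => _.
    exact: f_lt.
  by rewrite eq_sym f_lt.
have -> : A :|: B = w |: (A :|: (B :\ w)).
  by rewrite setUCA setD1K.
rewrite hdim_add_acyclic ?inE ?(negbTE Aw) ?eqxx //.
  apply: IHk.
  - by rewrite (cardsD1 w) Bw in B_k.
  - by apply: disjointWr dAB; apply: subD1set.
  move=> v; rewrite 2!inE => /andP[vw Bv]; have [c [lk_c cone_c]] := cones v Bv.
  (* Taking [w] out leaves the cones of the other vertices unchanged: [f w] being maximal, [w] was
     in none of them. *)
  have lkE u : [&& u \in A :|: (B :\ w), (u >=< v)%O, u != v & (u \in B :\ w) ==> (f u < f v)%N]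
     = [&& u \in A :|: B, (u >=< v)%O, u != v & (u \in B) ==> (f u < f v)%N].
    rewrite !inE; have [->|//] := eqVneq u w; rewrite (negbTE Aw) Bw /=.
    by rewrite ltnNge (w_max v Bv) !andbF.
  exists c => /=; rewrite lkE; split=> // u; rewrite lkE; exact: cone_c.
move=> k'; have [c [lk_c cone_c]] := cones w Bw.
have lkE u : (u \in [set u in A :|: B :\ w | (u >=< w)%O]) =
    [&& u \in A :|: B, (u >=< w)%O, u != w & (u \in B) ==> (f u < f w)%N].
  rewrite !inE; have [->|neq] := eqVneq u w.
    by rewrite (negbTE Aw) /= !andbF.
  have [cmp|] := boolP (u >=< w)%O; rewrite ?andbF ?andbT //=.
  by case: (boolP (u \in B)) => [Bu|_]; rewrite ?orbT ?orbF ?andbT //= f_w.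
apply: (@hdim_cone _ _ _ _ c); first by rewrite lkE.
by move=> u; rewrite lkE => /cone_c.
Qed.

(** Elements of an antichain are not in each other's links, so each one contributes the homology of
    its own link in the acyclic [A], one degree up. Topologically this is a wedge of suspensions. *)
Lemma hdim_add_antichain A B (g : nat -> nat) d :
    (forall m, hdim A m = 0%N) -> [disjoint A & B] ->
    {in B &, forall u w, (u >=< w)%O -> u = w} ->
    (forall m, m != d -> g m = 0%N) ->
    (forall w, w \in B -> forall m, hdim [set u in A | (u >=< w)%O] m = g m) ->
  hdim (A :|: B) 0 = 0%N /\ forall m, hdim (A :|: B) m.+1 = (#|B| * g m)%N.
Proof.
move=> A0 + + g0; elim: {B}_.+1 {-2}B (ltnSn #|B|) => // k IHk B B_k dAB anti links.
have [->|[w Bw]] := set_0Vmem B; first by rewrite setU0 cards0.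
have Aw : w \notin A by rewrite (disjointFl dAB Bw).
have sub u : u \in B :\ w -> u \in B by rewrite inE => /andP[].
have [|||| H0 H] := IHk (B :\ w).
- by rewrite (cardsD1 w) Bw in B_k.
- by apply: disjointWr dAB; apply: subD1set.
- by move=> u v /sub Bu /sub Bv; apply: anti.
- by move=> u /sub; apply: links.
have link_w : [set u in A :|: B :\ w | (u >=< w)%O] = [set u in A | (u >=< w)%O].
  apply/setP => u; rewrite !inE; case: (boolP (u >=< w)%O); rewrite ?andbF // => cmp.
  have [Bu|] := boolP (u \in B); rewrite ?andbF ?orbF //=.
  by rewrite (anti u w Bu Bw cmp) eqxx orbF.
have -> : A :|: B = w |: (A :|: (B :\ w)) by rewrite setUCA setD1K.
have [| m md | m md | H0' H'] := @hdim_add_concentrated F _ _ (A :|: (B :\ w)) w _ d.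
- by rewrite !inE (negbTE Aw) eqxx.
- by case: m md => [|m] // md; rewrite H g0 ?muln0.
- by rewrite link_w links ?g0.
split=> // m; rewrite H' H link_w links // (cardsD1 w B) Bw.
by rewrite add1n mulSn addnC.
Qed.

Definition interval_dim o x (r : nat) : nat :=
  if x == o then nat_of_bool (r == 0%N)
  else if r is m.+1 then hdim (open_interval o x) m else 0%N.

(** * One modular coatom [y] of the interval from [o] to [x] *)

Section ModularStep.
(** [res] plays the meet with [y], and [join] the join of an element of [At] with one below [y]; no
    more of a lattice structure is assumed. Modularity is in [res_join] and [join_res]: meeting with
    [y] undoes joining with [a], and joining with [a] undoes meeting with [y] above [a]. *)
Variables (o x y : T) (res : T -> T) (join : T -> T -> T).
Hypothesis bot : forall w, (o <= w)%O.
Hypothesis lt_yx : (y < x)%O.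
Hypothesis res_le : forall w, (w <= x)%O -> (res w <= w)%O && (res w <= y)%O.
Hypothesis res_max :
  forall w v, (w <= x)%O -> (v <= y)%O -> (v <= w)%O -> (v <= res w)%O.

Let At := [set a | [&& (a <= x)%O, a != o & res a == o]].

Hypothesis join_ub : forall a v, a \in At -> (v <= y)%O ->
  [/\ (v <= join a v)%O, (a <= join a v)%O & (join a v <= x)%O].
Hypothesis res_join : forall a v, a \in At -> (v <= y)%O -> res (join a v) = v.
Hypothesis join_lub : forall a v w, a \in At -> (v <= y)%O ->
  (w <= x)%O -> (a <= w)%O -> (v <= w)%O -> (join a v <= w)%O.
Hypothesis join_res : forall a w, a \in At -> (a <= w)%O -> (w <= x)%O ->
  (w <= join a (res w))%O.

Let res_x : res x = y.
Proof.
apply/le_anti; have /andP[_ ->] := res_le (lexx x).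
by rewrite res_max // ltW.
Qed.

Let AtP a : a \in At -> [/\ (a <= x)%O, a != o & res a = o].
Proof. by rewrite inE => /and3P[? ? /eqP]. Qed.

Let lt_o w : w != o -> (o < w)%O.
Proof. by move=> wo; rewrite lt_neqAle eq_sym wo bot. Qed.

Let At_ny a w : a \in At -> (a <= w)%O -> ~~ (w <= y)%O.
Proof.
move=> /AtP[ax ao res_a] aw; apply: contra ao => wy; rewrite eq_le bot andbT.
by rewrite -[leRHS]res_a res_max // (le_trans aw).
Qed.

Let res_o a w : a \in At -> (a <= w)%O -> (w <= x)%O -> res w = o -> w = a.
Proof.
move=> aAt aw wx rw; apply/le_anti; rewrite aw andbT.
have [ax _ _] := AtP aAt.
by apply: le_trans (join_res aAt aw wx) _; rewrite rw join_lub.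
Qed.

Let At_anti : {in At &, forall a b, (a >=< b)%O -> a = b}.
Proof.
move=> a b aAt bAt; have [ax _ ra] := AtP aAt; have [bx _ rb] := AtP bAt.
by case/orP => ab; [rewrite [RHS](res_o aAt) | rewrite [LHS](res_o bAt)].
Qed.

(** This decreases along the order, so adding vertices by increasing [up] goes from the top down. *)
Let up w := #|[set u | (w < u)%O]|.

Let up_lt u w : (u < w)%O -> (up w < up u)%N.
Proof.
move=> uw; apply/proper_card/properP; split; last by exists w; rewrite !inE ?ltxx.
by apply/subsetP => v; rewrite !inE; apply: lt_trans.
Qed.

Let up_neq u w : (u < w)%O -> up u != up w.
Proof. by move=> /up_lt; rewrite ltn_neqAle eq_sym => /andP[]. Qed.

(** Both intervals are compared with their union [I :|: J]. It is built from [I] from the top down,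
    with [res w] as apex of the link of [w], and from [J] from the bottom up, with [join a v] as
    apex of the link of [v]. *)
Let hdim_link a m : a \in At ->
  hdim (open_interval a x) m = hdim (open_interval o y) m.
Proof.
move=> aAt; have [ax ao res_a] := AtP aAt.
set J := open_interval a x; set I := open_interval o y.
have JP w : w \in J -> [/\ (a < w)%O, (w < x)%O & ~~ (w <= y)%O].
  by rewrite inE => /andP[aw wx]; rewrite (At_ny aAt (ltW aw)).
have IP v : v \in I -> (o < v)%O /\ (v < y)%O by rewrite inE => /andP[].
have dIJ : [disjoint I & J].
  apply/pred0P => w /=; apply/negP => /andP[/IP[_ /ltW wy] /JP[_ _]].
  by rewrite wy.
have <- : hdim (I :|: J) m = hdim I m.
  apply: (@hdim_add_cones _ _ up) => // w wJ; have [aw wx wy] := JP w wJ.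
  have /andP[rw ry] := res_le (ltW wx).
  have rwI : res w \in I.
    rewrite inE lt_o /=; last first.
      by apply: contraTneq (aw) => /(res_o aAt (ltW aw) (ltW wx)) ->; rewrite ltxx.
    rewrite lt_neqAle ry andbT; apply: contraTneq (wx) => rwy; rewrite le_gtF //.
    apply: le_trans (join_res aAt ax (lexx x)) _.
    by rewrite res_x join_lub ?(ltW aw) ?(ltW wx) // -rwy.
  have rw_neq : res w != w by apply: contra wy => /eqP <-.
  exists (res w); split.
    rewrite inE rwI /= /Order.comparable rw rw_neq /=.
    by rewrite (disjointFr dIJ rwI).
  move=> u /and4P[/setUP[uI|uJ] cmp neq lt_up].
    have [uo uy] := IP u uI; rewrite /Order.comparable res_max ?(ltW uy) ?(ltW wx) //.
    case/orP: cmp => // wu; case/negP: wy; exact: le_trans wu (ltW uy).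
  rewrite uJ /= in lt_up; rewrite /Order.comparable; apply/orP; right.
  apply: le_trans rw _; case: (comparable_ltgtP cmp) neq lt_up => [|/ltW//|->].
    by move=> /up_lt wu _ /(ltn_trans wu); rewrite ltnn.
  by [].
rewrite setUC; symmetry; apply: (@hdim_add_cones _ _ (@lin_ext _ T)).
- by rewrite disjoint_sym.
- by move=> u w /lin_ext_lt; rewrite ltn_neqAle => /andP[].
move=> v vI; have [vo vy] := IP v vI.
have [vj aj jx] := join_ub aAt (ltW vy); have rj := res_join aAt (ltW vy).
have jJ : join a v \in J.
  rewrite inE !lt_neqAle aj jx !andbT; apply/andP; split.
    apply: contraTneq vo => a_j.
    by move: rj; rewrite -a_j res_a => ->; rewrite ltxx.
  by apply: contraTneq vy => j_x; move: rj; rewrite j_x res_x => ->; rewrite ltxx.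
have [_ _ jy] := JP _ jJ.
exists (join a v); split.
  rewrite inE jJ /= /Order.comparable vj orbT (disjointFl dIJ jJ) /= andbT.
  by apply: contraNneq jy => ->; apply: ltW.
move=> u /and4P[/setUP[uJ|uI] cmp neq lt_ext].
  have [au ux uy] := JP u uJ; rewrite /Order.comparable.
  rewrite join_lub ?orbT ?(ltW vy) ?(ltW ux) ?(ltW au) //.
  by case/orP: cmp => // uv; case/negP: uy; apply: le_trans uv (ltW vy).
rewrite uI /= in lt_ext; rewrite /Order.comparable; apply/orP; left.
apply: le_trans vj; case: (comparable_ltgtP cmp) neq lt_ext => [/ltW//|vu|->].
  by move=> _ /(ltn_trans (lin_ext_lt vu)); rewrite ltnn.
by [].
Qed.

Lemma interval_dim_modular d :
    (forall r, r != d -> interval_dim o y r = 0%N) ->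
  interval_dim o x 0 = 0%N /\
  forall r, interval_dim o x r.+1 = (#|At| * interval_dim o y r)%N.
Proof.
have xo : x != o by apply: contraTneq lt_yx => ->; rewrite le_gtF.
(* If [y = o], then [x] is an atom and [At] is its singleton; the convention in degree -2 for [o]
   matches the empty complex of [x]. *)
rewrite /interval_dim (negbTE xo); have [yo|yo] := eqVneq y o => conc.
  split=> // r.
  have xAt : x \in At by rewrite inE lexx xo res_x yo eqxx.
  have At_le a : (a <= x)%O -> a != o -> a = x.
    move=> ax ao; apply: At_anti => //; last by rewrite /Order.comparable ax.
    by rewrite inE ax ao /= eq_le bot -yo; have /andP[_ ->] := res_le ax.
  have -> : At = [set x].
    apply/setP => a; rewrite in_set1; apply/idP/eqP => [/AtP[ax ao _]|->//].
    exact: At_le.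
  have -> : open_interval o x = set0.
    apply/setP => w; rewrite !inE; apply/negP => /andP[ow wx].
    by have := wx; rewrite (At_le w (ltW wx)) ?ltxx // gt_eqF.
  by rewrite cards1 mul1n hdim_set0.
split=> // r.
(* [A0] is a cone with apex [y], and [W1] is added to it from the top down, with [res w] as apex of
   the link of [w]. *)
pose A0 := [set w | (o < w <= y)%O].
pose W1 := [set w | [&& (w < x)%O, ~~ (w <= y)%O & res w != o]].
have d01 : [disjoint A0 & W1].
  apply/pred0P => w /=; apply/negP; rewrite !inE => /andP[/andP[_ ->]].
  by rewrite andbF.
have A0W1 m : hdim (A0 :|: W1) m = 0%N.
  transitivity (hdim A0 m); last first.
    apply: (@hdim_cone _ _ _ _ y); first by rewrite inE lexx lt_o.
    by move=> w; rewrite inE /Order.comparable => /andP[_ ->].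
  apply: (@hdim_add_cones _ _ up) => // w; rewrite inE => /and3P[wx wy rwo].
  have /andP[rw ry] := res_le (ltW wx).
  have rw0 : res w \in A0 by rewrite inE lt_o.
  exists (res w); split.
    rewrite inE rw0 /= /Order.comparable rw (disjointFr d01 rw0) /= andbT.
    by apply: contraNneq wy => <-.
  move=> u /and4P[/setUP[u0|u1] cmp neq lt_up]; rewrite /Order.comparable.
    move: u0; rewrite inE => /andP[_ uy]; rewrite res_max ?(ltW wx) //.
    by case/orP: cmp => // wu; case/negP: wy; apply: le_trans wu uy.
  rewrite u1 /= in lt_up; apply/orP; right.
  apply: le_trans rw _; case: (comparable_ltgtP cmp) neq lt_up => [|/ltW//|->].
    by move=> /up_lt wu _ /(ltn_trans wu); rewrite ltnn.
  by [].
have dAt : [disjoint A0 :|: W1 & At].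
  apply/pred0P => a /=; apply/negP => /andP[/setUP[|] aA aAt].
    by move: aA; rewrite inE (negbTE (At_ny aAt (lexx a))) andbF.
  by move: aA; have [_ _ ra] := AtP aAt; rewrite inE ra eqxx !andbF.
have def_x : open_interval o x = A0 :|: W1 :|: At.
  apply/setP => w; rewrite !inE; apply/andP/idP => [[ow wx]|].
    rewrite ow wx (ltW wx) (gt_eqF ow) /=.
    by case: (w <= y)%O => //=; case: eqP.
  case/orP => [/orP[/andP[ow wy]|/and3P[wx wy _]]|/and3P[wx wo rw]].
  - by split=> //; apply: le_lt_trans lt_yx.
  - by split=> //; apply: lt_o; apply: contraNneq wy => ->; apply: bot.
  - split; first exact: lt_o.
    rewrite lt_neqAle wx andbT; apply: contra (yo) => /eqP w_x.
    by rewrite -res_x -w_x.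
(* An element of [A0] or [W1] below [a] would give a nonzero element below both [a] and [y], against
   [res a = o]. *)
have link a : a \in At ->
    [set w in A0 :|: W1 | (w >=< a)%O] = open_interval a x.
  move=> aAt; have [ax ao ra] := AtP aAt.
  apply/setP => w; apply/idP/idP.
    rewrite inE => /andP[wA cmp].
    have wx : (w < x)%O.
      case/setUP: wA; rewrite inE; last by case/and3P.
      by case/andP => _ /le_lt_trans; apply.
    rewrite inE wx andbT; case: (comparable_ltgtP cmp) => // [wa|w_a]; last first.
      by move: wA; rewrite w_a (disjointFl dAt aAt).
    case/setUP: wA; rewrite inE.
      case/andP => ow wy; have := res_max ax wy (ltW wa).
      by rewrite ra => /(lt_le_trans ow); rewrite ltxx.
    case/and3P => _ _; have /andP[rw ry] := res_le (ltW wx).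
    have := res_max ax ry (le_trans rw (ltW wa)).
    by rewrite ra eq_le bot andbT => ->.
  move=> wI; have /andP[aw wx] : (a < w < x)%O by rewrite inE in wI.
  rewrite !inE wx (At_ny aAt (ltW aw)) /=.
  rewrite /Order.comparable (ltW aw) orbT andbT; apply/orP; right.
  by apply: contraTneq (aw) => /(res_o aAt (ltW aw) (ltW wx)) ->; rewrite ltxx.
rewrite def_x.
(* [interval_dim] is indexed one above [hdim], hence [d.-1]; for [d = 0] the homology of the
   interval below [y] vanishes and any degree would do. *)
have [|m md|a aAt m|H0 H] :=
  @hdim_add_antichain (A0 :|: W1) At (hdim (open_interval o y)) d.-1 A0W1 dAt.
- exact: At_anti.
- by apply: (conc m.+1); apply: contraNneq md => <-.
- by rewrite link // hdim_link.
by case: r => [|m]; rewrite ?muln0 ?H0 ?H.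
Qed.
End ModularStep.
End PosetTopology.

(** * Normal forms of Dowling elements *)

Local Notation dom := Defs.dom.
Local Notation pcomp := Defs.pcomp.

Section Colorings.
Variables (n : nat) (gT : finGroupType).
Implicit Types (a b : coloring n gT) (g h : gT) (i : 'I_n).

Lemma shiftE b g i : shift b g i = omap (fun u => u * g)%g (b i).
Proof. by rewrite ffunE. Qed.

Lemma shift1 b : shift b 1 = b.
Proof. by apply/ffunP => i; rewrite shiftE; case: (b i) => //= u; rewrite mulg1. Qed.

Lemma shiftM b g h : shift (shift b g) h = shift b (g * h).
Proof. by apply/ffunP => i; rewrite !shiftE; case: (b i) => //= u; rewrite mulgA. Qed.

Lemma proj_coloring_shift b g : proj_coloring (shift b g) = proj_coloring b.
Proof.
apply/setP => a; apply/imsetP/imsetP => -[h _ ->].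
  by exists (g * h)%g; rewrite ?shiftM.
by exists (g^-1 * h)%g; rewrite ?shiftM ?mulKVg.
Qed.

Lemma proj_coloring_eq a b :
  proj_coloring a = proj_coloring b -> exists g, a = shift b g.
Proof.
move=> eq_ab; have : a \in proj_coloring a by apply/imsetP; exists 1%g; rewrite ?shift1.
by rewrite eq_ab => /imsetP[g _ ->]; exists g.
Qed.

Lemma proj_coloring_dom a b : proj_coloring a = proj_coloring b -> dom a = dom b.
Proof. by move/proj_coloring_eq => [g ->]; apply: dom_pcomp. Qed.

(** Only the relative shift of the two pieces matters, since the whole can be rescaled by [g]. *)
Lemma proj_coloring_glue a b g h :
  proj_coloring (glue (shift a g) (shift b h)) =
  proj_coloring (glue a (shift b (h * g^-1))).
Proof.
rewrite -(proj_coloring_shift (glue a _) g); congr proj_coloring.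
apply/ffunP => i; rewrite ffunE !shiftE ffunE.
case: (a i) => //=; rewrite !shiftE; case: (b i) => //= u.
by rewrite -!mulgA mulVg mulg1.
Qed.

Lemma glueC a b : [disjoint dom a & dom b] -> glue a b = glue b a.
Proof.
move=> /pred0P dab; apply/ffunP => i; rewrite !ffunE; have := dab i.
by rewrite /= !inE; case: (a i) => //= u; case: (b i).
Qed.

End Colorings.

(* A normal form sends [i] to its color if [i] is in the zero block, and to
   [(m, b i)] if [i] lies in the block of minimum [m], where [b] is the coloring
   of that block with [b m = 1]. It is thus an idempotent substitution, and the
   Dowling order is the order of substitutions: [q] is below [q'] if and only if
   substituting [q'] in [q] gives [q']. *)
Section NormalForms.
Variables (n : nat) (gT : finGroupType) (S : finType) (act : gT -> S -> S).
Hypothesis act1 : forall s, act 1%g s = s.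
Hypothesis actM : forall g h s, act (g * h)%g s = act g (act h s).

Local Notation point := (S + 'I_n * gT)%type.
Local Notation form := {ffun 'I_n -> point}.
Implicit Types (q : form) (p : point) (i j k l m : 'I_n) (g h : gT) (s : S).

Definition pact g p : point :=
  match p with inl s => inl (act g s) | inr (m, h) => inr (m, (g * h)%g) end.

Definition subst p q : point :=
  match p with inl s => inl s | inr (m, g) => pact g (q m) end.

Lemma pact1 p : pact 1 p = p.
Proof. by case: p => [s|[m h]] /=; rewrite ?act1 ?mul1g. Qed.

Lemma pactM g h p : pact (g * h) p = pact g (pact h p).
Proof. by case: p => [s|[m k]] /=; rewrite ?actM ?mulgA. Qed.

Lemma subst_pact g p q : subst (pact g p) q = pact g (subst p q).
Proof. by case: p => [s|[m h]] //=; rewrite pactM. Qed.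

Definition is_root q m := q m == inr (m, 1%g).

Definition is_form q := [forall i, if q i is inr (m, _) then (m <= i)%N && is_root q m else true].

Lemma is_formP q : reflect (forall i m g, q i = inr (m, g) -> (m <= i)%N /\ is_root q m)
  (is_form q).
Proof.
apply: (iffP forallP) => [fq i m g qi|fq i].
  by have := fq i; rewrite qi => /andP.
by case qi: (q i) => [s|[m g]] //; have [-> ->] := fq i m g qi.
Qed.

Lemma subst_idem q i : is_form q -> subst (q i) q = q i.
Proof.
move=> /is_formP fq; case qi: (q i) => [s|[m g]] //=.
by have [_ /eqP ->] := fq i m g qi; rewrite /= mulg1.
Qed.

Definition form_le q q' := [forall i, q' i == subst (q i) q'].

Lemma form_leP q q' : reflect (forall i, q' i = subst (q i) q') (form_le q q').
Proof. by apply: (iffP forallP) => H i; apply/eqP. Qed.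

Lemma form_le_refl q : is_form q -> form_le q q.
Proof. by move=> fq; apply/form_leP => i; rewrite subst_idem. Qed.

Lemma form_le_trans q q' q'' : form_le q q' -> form_le q' q'' -> form_le q q''.
Proof.
move=> /form_leP le1 /form_leP le2; apply/form_leP => i; rewrite le2 le1.
case: (q i) => [s|[m g]] //=; by rewrite subst_pact -le2.
Qed.

Definition form_block q m : coloring n gT :=
  [ffun i => if q i is inr (k, g) then if k == m then Some g else None else None].

Definition form_parts q : {set {set coloring n gT}} :=
  [set proj_coloring (form_block q m) | m in [set m | is_root q m]].

Definition form_zero q : {ffun 'I_n -> option S} :=
  [ffun i => if q i is inl s then Some s else None].

Lemma form_blockP q m i g : reflect (q i = inr (m, g)) (form_block q m i == Some g).
Proof.
rewrite ffunE; apply: (iffP eqP) => [|->]; last by rewrite eqxx.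
by case: (q i) => [s|[k h]] //; case: eqP => // -> [->].
Qed.

Lemma dom_form_blockP q m i :
  reflect (exists g, q i = inr (m, g)) (i \in dom (form_block q m)).
Proof.
rewrite inE; apply: (iffP idP) => [|[g qi]].
  case b_i: (form_block q m i) => [g|] // _; exists g.
  by apply/form_blockP; rewrite b_i.
by have /eqP -> : form_block q m i == Some g by apply/form_blockP.
Qed.

Lemma root_dom q m : is_root q m -> m \in dom (form_block q m).
Proof. by move=> /eqP qm; apply/dom_form_blockP; exists 1%g. Qed.

Lemma form_block_disjoint q m k : m != k ->
  [disjoint dom (form_block q m) & dom (form_block q k)].
Proof.
move=> mk; apply/pred0P => i /=; apply/negP.
case/andP => /dom_form_blockP[g qi] /dom_form_blockP[h]; rewrite qi => -[m_k _].
by rewrite m_k eqxx in mk.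
Qed.

Lemma form_block_inj q : {in is_root q &, injective (fun m => proj_coloring (form_block q m))}.
Proof.
move=> m k rm rk /proj_coloring_dom eq_dom; apply/eqP; apply: contraT => mk.
have /pred0P/(_ m) := form_block_disjoint q mk.
by rewrite /= -eq_dom root_dom.
Qed.

Lemma form_partsP q B :
  reflect (exists2 m, is_root q m & B = proj_coloring (form_block q m)) (B \in form_parts q).
Proof.
by apply: (iffP imsetP) => -[m rm ->]; exists m; rewrite ?inE // in rm *.
Qed.

Lemma form_pred q : is_form q -> dowling_pred (form_parts q, form_zero q).
Proof.
move=> fq; rewrite /dowling_pred /=; apply/andP; split.
  apply/andP; split.
    apply/forall_inP => _ /form_partsP[m rm ->]; apply/existsP.
    exists (form_block q m); rewrite eqxx andbT; apply/set0Pn.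
    by exists m; apply: root_dom.
  apply/forall_inP => _ /form_partsP[m rm ->]; apply/forall_inP => _ /form_partsP[k rk ->].
  apply/implyP => neq; rewrite !block_proj_coloring form_block_disjoint //.
  by apply: contraNneq neq => ->.
apply/eqP/setP => i; rewrite !inE ffunE; case qi: (q i) => [s|[m g]] /=.
  apply/esym/bigcupP => -[_ /form_partsP[k rk ->]]; rewrite block_proj_coloring.
  by case/dom_form_blockP => h; rewrite qi.
apply/esym/negbF/bigcupP; have [_ rm] := is_formP _ fq i m g qi.
exists (proj_coloring (form_block q m)); first by apply/form_partsP; exists m.
by rewrite block_proj_coloring; apply/dom_form_blockP; exists g.
Qed.

Local Notation D := (dowling n act).

Definition of_form q : D := insubd (dowling_zero n act) (form_parts q, form_zero q).

Lemma of_form_val q : is_form q -> dval (of_form q) = (form_parts q, form_zero q).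
Proof. by move=> fq; rewrite [dval _]val_insubd form_pred. Qed.

Lemma of_form_eq q (x : D) : is_form q ->
  (dval x).1 = form_parts q -> (dval x).2 = form_zero q -> x = of_form q.
Proof.
move=> fq e1 e2; apply/val_inj; rewrite [val (of_form q)]of_form_val // -e1 -e2.
exact: surjective_pairing.
Qed.

Lemma root_dom_le q m i : is_form q -> i \in dom (form_block q m) -> (m <= i)%N.
Proof. by move=> /is_formP fq /dom_form_blockP[g /fq[]]. Qed.

(** The root of a block is the minimum of its domain, and the color 1 at the root fixes the scaling,
    so a projectivized block determines its coloring. *)
Lemma of_form_inj : {in is_form &, injective of_form}.
Proof.
suff sub q q' : is_form q -> is_form q' -> of_form q = of_form q' ->
    forall i m g, q i = inr (m, g) -> q' i = inr (m, g).
  move=> q q' fq fq' eq_qq'; apply/ffunP => i.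
  case qi: (q i) => [s|[m g]]; last by rewrite (sub q q' fq fq' eq_qq' _ _ _ qi).
  case qi': (q' i) => [s'|[m g]]; last first.
    by rewrite (sub q' q fq' fq (esym eq_qq') _ _ _ qi') in qi.
  have := congr1 (fun x : D => (dval x).2 i) eq_qq'.
  by rewrite /= !of_form_val // !ffunE qi qi' => -[->].
move=> fq fq' eq_qq' i m g qi; have [_ rm] := is_formP _ fq i m g qi.
have : proj_coloring (form_block q m) \in form_parts q'.
  have := congr1 (fun x : D => (dval x).1) eq_qq'; rewrite /= !of_form_val //= => <-.
  by apply/form_partsP; exists m.
case/form_partsP => m' rm' eq_b; have eq_dom := proj_coloring_dom eq_b.
have m_m' : m = m'.
  apply/val_inj/anti_leq/andP; split.
    by apply: root_dom_le fq _; rewrite eq_dom root_dom.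
  by apply: root_dom_le fq' _; rewrite -eq_dom root_dom.
have [h eq_h] := proj_coloring_eq eq_b; rewrite -m_m' in eq_h rm'.
have h1 : h = 1%g.
  have := congr1 (fun b : coloring n gT => b m) eq_h; rewrite /= shiftE !ffunE.
  by rewrite (eqP rm) (eqP rm') eqxx /= => -[]; rewrite mul1g.
apply/form_blockP; rewrite -(shift1 (form_block q' m)) -h1 -eq_h.
exact/form_blockP.
Qed.

Definition step_ok q m p : bool :=
  if p is inr (k, _) then (k < m)%N && is_root q k else true.

(** * Elementary steps between normal forms *)

Section Step.
Variables (q : form) (m : 'I_n) (p : point).
Hypotheses (fq : is_form q) (rm : is_root q m).

(** The point [p] is substituted for the root [m]: this colors the block of [m], or merges it into
    the block of [k]. The condition [k < m] of [step_ok] keeps [k] the minimum of the union. *)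
Definition step : form :=
  [ffun i => if q i is inr (k, g) then if k == m then pact g p else q i else q i].

Lemma step_le : form_le q step.
Proof.
apply/form_leP => i; rewrite /step !ffunE; case qi: (q i) => [s|[k g]] //=.
have [_ /eqP rk] := is_formP _ fq i k g qi.
by rewrite !ffunE rk; case: (k == m); rewrite /= ?pact1 ?mulg1.
Qed.

Lemma step_min q' : is_form q' -> form_le q q' -> p = q' m -> form_le step q'.
Proof.
move=> fq' /form_leP le_qq' def_p; apply/form_leP => i; rewrite ffunE {1}le_qq'.
case: (q i) => [s|[k g]] //=; case: eqP => [->|] //.
by rewrite def_p subst_pact subst_idem.
Qed.

Hypothesis ok_p : step_ok q m p.

Lemma step_root k : is_root step k = (k != m) && is_root q k.
Proof.
have [->|km] := eqVneq k m.
  rewrite /is_root ffunE (eqP rm) eqxx /=; case: p ok_p => [? //|[l h]] /= /andP[lm _].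
  by apply/negbTE; apply: contraTneq lm => -[-> _]; rewrite ltnn.
rewrite /is_root ffunE; case qk: (q k) => [//|[l g]]; have [l_m|//] := eqVneq l m.
rewrite l_m /= (_ : (inr _ == inr (k, _)) = false); last first.
  by apply/eqP => -[m_k]; rewrite m_k eqxx in km.
case: p ok_p => [? //|[l' h]] /= /andP[_ rl]; apply/negbTE/eqP => -[l_k _].
by move: rl; rewrite /is_root l_k qk l_m => /eqP[m_k]; rewrite m_k eqxx in km.
Qed.

Lemma step_form : is_form step.
Proof.
apply/is_formP => i k g; rewrite step_root ffunE; case qi: (q i) => [s|[l h]] //.
have [li rl] := is_formP _ fq i l h qi.
have [l_m|lm] := eqVneq l m; last by case=> <- _; rewrite lm.
case: p ok_p => [? //|[k' h']] /= /andP[km rk] [<- _]; split.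
  by rewrite ltnW // (leq_trans km) // -l_m.
by rewrite rk andbT; apply: contraTneq km => ->; rewrite ltnn.
Qed.

Lemma step_card : (#|[set k | is_root step k]| < #|[set k | is_root q k]|)%N.
Proof.
apply/proper_card/properP; split.
  by apply/subsetP => k; rewrite !inE step_root => /andP[].
by exists m; rewrite inE ?step_root ?eqxx.
Qed.

End Step.

Lemma step_color q m s : is_form q -> is_root q m ->
  form_parts (step q m (inl s)) = form_parts q :\ proj_coloring (form_block q m) /\
  form_zero (step q m (inl s)) =
    glue (form_zero q) (pcomp (fun g => act g s) (form_block q m)).
Proof.
move=> fq rm; have block_k k : k != m ->
    form_block (step q m (inl s)) k = form_block q k.
  move=> km; apply/ffunP => i; rewrite !ffunE; case qi: (q i) => [? //|[l g]].
  by have [->|_] := eqVneq l m; rewrite ?qi //= eq_sym (negbTE km).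
split; last first.
  apply/ffunP => i; rewrite !ffunE; case qi: (q i) => [? //|[l g]].
  by case: eqP.
apply/setP => B; rewrite in_setD1; apply/form_partsP/andP => [[k]|[Bm /form_partsP[k rk def_B]]].
  rewrite step_root // => /andP[km rk] ->; rewrite block_k //; split.
    by apply: contra km => /eqP/form_block_inj ->.
  by apply/form_partsP; exists k.
have km : k != m by apply: contraNneq Bm => <-; rewrite def_B.
by exists k; rewrite ?block_k // step_root // km.
Qed.

Lemma step_merge q k m h : is_form q -> is_root q k -> is_root q m -> (k < m)%N ->
  form_parts (step q m (inr (k, h))) =
    proj_coloring (glue (form_block q k) (shift (form_block q m) h))
      |: ((form_parts q :\ proj_coloring (form_block q k)) :\ proj_coloring (form_block q m)) /\
  form_zero (step q m (inr (k, h))) = form_zero q.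
Proof.
move=> fq rk rm lt_km; have km : k != m by apply: contraTneq lt_km => ->; rewrite ltnn.
have ok : step_ok q m (inr (k, h)) by rewrite /= lt_km.
have block_l l : l != m -> l != k ->
    form_block (step q m (inr (k, h))) l = form_block q l.
  move=> lm lk; apply/ffunP => i; rewrite !ffunE; case qi: (q i) => [? //|[l' g]].
  have [->|_] := eqVneq l' m; rewrite ?qi //=.
  by rewrite eq_sym (negbTE lk) eq_sym (negbTE lm).
have block_k : form_block (step q m (inr (k, h))) k =
    glue (form_block q k) (shift (form_block q m) h).
  apply/ffunP => i; rewrite !ffunE; case qi: (q i) => [? //|[l g]].
  have [->|lm] := eqVneq l m; first by rewrite /= eqxx eq_sym (negbTE km).
  by case: (l == k).
split; last first.
  apply/ffunP => i; rewrite !ffunE; case qi: (q i) => [? //|[l g]].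
  by case: eqP.
apply/setP => B; rewrite in_setU1 !in_setD1; apply/form_partsP/idP => [[l]|].
  rewrite step_root // => /andP[lm rl] ->; have [->|lk] := eqVneq l k.
    by rewrite block_k eqxx.
  rewrite block_l //; apply/orP; right; apply/and3P; split.
  - by apply: contra lm => /eqP/form_block_inj ->.
  - by apply: contra lk => /eqP/form_block_inj ->.
  - by apply/form_partsP; exists l.
case/orP => [/eqP ->|/and3P[Bm Bk /form_partsP[l rl def_B]]].
  by exists k; rewrite ?block_k // step_root // km.
have lm : l != m by apply: contraNneq Bm => <-; rewrite def_B.
have lk : l != k by apply: contraNneq Bk => <-; rewrite def_B.
by exists l; rewrite ?block_l // step_root // lm.
Qed.

(** * The Dowling order as the order of substitutions *)

Lemma dowling_leE (x y : D) : (x <= y)%O = dowling_le x y.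
Proof. by []. Qed.

Lemma cover_of_step q m p : is_form q -> is_root q m -> step_ok q m p ->
  dowling_cover (of_form q) (of_form (step q m p)).
Proof.
move=> fq rm ok; have fs := step_form fq rm ok; rewrite /dowling_cover.
have in_parts k : is_root q k -> proj_coloring (form_block q k) \in form_parts q.
  by move=> rk; apply/form_partsP; exists k.
case: p ok fs => [s _|[k h] /andP[km rk]] fs; apply/orP; [right|left].
  have [e1 e2] := step_color s fq rm.
  (* The equivariant map with value [s] at 1, the color of the root. *)
  apply/existsP; exists (form_block q m); apply/existsP; exists [ffun g => act g s].
  rewrite !of_form_val // in_parts // e1 e2 !eqxx /=; apply/andP; split.
    by apply/forallP => h; apply/forallP => u; rewrite !ffunE actM.
  by apply/eqP; congr glue; apply/ffunP => i; rewrite !ffunE; case: (q i) => [//|[l g]];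
    case: eqP => //= _; rewrite ffunE.
have [e1 e2] := step_merge h fq rk rm km.
rewrite /dowling_merge !of_form_val //= e1 e2 eqxx /=.
apply/existsP; exists (form_block q k); apply/existsP; exists (form_block q m).
apply/existsP; exists h; rewrite !in_parts // eqxx andbT /=.
apply: contraTneq km => /form_block_inj -> //; by rewrite ltnn.
Qed.

Lemma form_of_cover q (y : D) : is_form q -> dowling_cover (of_form q) y ->
  exists q', [/\ is_form q', form_le q q' & y = of_form q'].
Proof.
move=> fq; rewrite /dowling_cover /dowling_merge /dowling_color of_form_val //=.
have mergeP k l h : is_root q k -> is_root q l -> (k < l)%N ->
    (dval y).2 = form_zero q -> (dval y).1 =
      proj_coloring (glue (form_block q k) (shift (form_block q l) h))
      |: ((form_parts q :\ proj_coloring (form_block q k)) :\ proj_coloring (form_block q l)) ->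
    exists q', [/\ is_form q', form_le q q' & y = of_form q'].
  move=> rk rl kl y2 y1; have [e1 e2] := step_merge h fq rk rl kl.
  have fs : is_form (step q l (inr (k, h))) by apply: step_form; rewrite //= kl.
  exists (step q l (inr (k, h))); split=> //; first exact: step_le.
  by apply: of_form_eq; rewrite ?e1 ?e2.
case/orP.
  case/andP => /eqP y2 /existsP[a /existsP[b /existsP[g]]].
  case/and4P => /form_partsP[k rk ak] /form_partsP[l rl bl] neq_ab /eqP y1.
  have [g1 def_a] := proj_coloring_eq ak; have [g2 def_b] := proj_coloring_eq bl.
  (* The given representatives are the normalized colorings shifted by [g1] and [g2], which changes
     the merging factor to [g2 * g * g1^-1]. *)
  move: y1; rewrite ak bl def_a def_b shiftM proj_coloring_glue.
  move: (g2 * g * g1^-1)%g => h y1.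
  have kl : k != l by apply: contraNneq neq_ab => kl; rewrite ak bl kl.
  case: (ltngtP k l) => [lt_kl|lt_lk|/val_inj/eqP]; last by rewrite (negbTE kl).
    exact: mergeP rk rl lt_kl y2 y1.
  (* The block with the smaller minimum has to absorb the other; exchanging them inverts the
     factor. *)
  apply: (mergeP l k h^-1%g rl rk lt_lk y2); rewrite y1; congr (_ |: _).
    rewrite glueC; last by rewrite dom_pcomp form_block_disjoint.
    by rewrite -[form_block q k in LHS]shift1 proj_coloring_glue mul1g.
  by rewrite !setDDl setUC.
case/existsP => b /existsP[f /and4P[/forallP eqv /form_partsP[m rm bm] /eqP y1 /eqP y2]].
have [g def_b] := proj_coloring_eq bm.
(* [b] has color [g] at the root, which therefore receives [f g]; equivariance gives the rest of the
   block. *)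
have [e1 e2] := step_color (f g) fq rm.
exists (step q m (inl (f g))); split; [exact: step_form|exact: step_le|].
apply: of_form_eq; rewrite ?e1 ?e2 -?bm //; first exact: step_form.
rewrite y2 def_b; congr glue; apply/ffunP => i; rewrite !ffunE.
case: (q i) => [//|[l h]]; case: eqP => //= _.
by have /forallP/(_ g)/eqP -> := eqv h.
Qed.

(** Covers are substitutions, which gives one direction. Conversely, a root [m] of [q] that is no
    longer one in [q'] is moved to [q' m]; this stays below [q'] and lowers the number of roots. If
    no root is lost, the forms are equal. *)
Lemma of_form_le q q' : is_form q -> is_form q' ->
  (of_form q <= of_form q')%O = form_le q q'.
Proof.
move=> fq fq'; rewrite dowling_leE; apply/idP/idP.
  have reach y : dowling_le (of_form q) y ->
      exists q1, [/\ is_form q1, form_le q q1 & y = of_form q1].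
  case/connectP => s; elim: s q fq => [|u s IHs] q fq /=.
      by move=> _ ->; exists q; split=> //; apply: form_le_refl.
    case/andP => /(form_of_cover fq)[q1 [fq1 le_qq1 ->]] /(IHs _ fq1)/[apply].
    by case=> q2 [fq2 le_q12 ->]; exists q2; split=> //; apply: form_le_trans le_q12.
  by case/reach => q1 [fq1 le_qq1] /(of_form_inj fq' fq1) ->.
have [k lt_k] := ubnP #|[set k | is_root q k]|.
elim: k q fq lt_k => // k IHk q fq lt_k le_qq'.
have [all_root|] := boolP [forall m, is_root q m ==> is_root q' m].
  suff -> : q' = q by apply: connect0.
  apply/ffunP => i; rewrite (form_leP _ _ le_qq'); case qi: (q i) => [s|[m g]] //=.
  have [_ rm] := is_formP _ fq i m g qi.
  by have := implyP (forallP all_root m) rm => /eqP -> /=; rewrite mulg1.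
case/forallPn => m; rewrite negb_imply => /andP[rm q'm].
have ok : step_ok q m (q' m).
  rewrite /step_ok; case q'm_eq: (q' m) => [//|[l h]]; have [lm /eqP rl] := is_formP _ fq' m l h q'm_eq.
  have ml : l != m by apply: contraNneq q'm => <-; apply/eqP.
  rewrite ltn_neqAle lm andbT ml /=.
  (* A block of [q] that meets a block of [q'] lies inside it, so the minimum [l] of the larger one
     is also a minimum in [q]. *)
  have := form_leP _ _ le_qq' l; rewrite rl; case ql: (q l) => [//|[l' g]] /=.
  have [l'l rl'] := is_formP _ fq l l' g ql.
  case q'l': (q' l') => [//|[l'' g']] /= [l''_l _].
  have [l''l' _] := is_formP _ fq' l' l'' g' q'l'.
  suff -> : l = l' by [].
  by apply/val_inj/anti_leq; rewrite l'l andbT l''_l.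
have cov := @cover_of_step q m (q' m) fq rm ok.
apply: (dowling_le_trans (connect1 cov)).
apply: IHk; first exact: step_form.
  exact: leq_trans (step_card rm ok) lt_k.
exact: step_min le_qq' _.
Qed.

Lemma of_form_onto (x : D) : exists2 q, is_form q & of_form q = x.
Proof.
case def_x: (dval x) => [beta z].
have /andP[/andP[/forall_inP/= beta_col /forall_inP/= beta_dis] /eqP/= dom_z] :
  dowling_pred (beta, z) by rewrite -def_x; apply: (valP x).
have same_block a b i : proj_coloring a \in beta -> proj_coloring b \in beta ->
    i \in dom a -> i \in dom b -> exists g, a = shift b g.
  move=> aB bB ia ib; apply/proj_coloring_eq/eqP; apply: contraT => neq.
  have /forall_inP/(_ _ bB)/implyP/(_ neq) := beta_dis _ aB.
  by rewrite !block_proj_coloring => /pred0P/(_ i); rewrite /= ia ib.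
have not_zero b i : proj_coloring b \in beta -> i \in dom b -> z i = None.
  move=> bB ib; have : i \notin dom z.
    rewrite dom_z inE negbK; apply/bigcupP; exists (proj_coloring b) => //.
    by rewrite block_proj_coloring.
  by rewrite inE; case: (z i).
(* The representative [b] of a block of [beta] with color 1 at its minimum [m]. *)
pose norm b m := [/\ proj_coloring b \in beta, b m = Some 1%g &
                     forall k, k \in dom b -> (m <= k)%N].
have norm_exists b i : proj_coloring b \in beta -> i \in dom b ->
    exists a m, norm a m /\ proj_coloring a = proj_coloring b.
  move=> bB ib; case: (arg_minnP (fun k : 'I_n => k : nat) ib) => m mb min_m.
  have {mb} : m \in dom b := mb; rewrite inE; case bm: (b m) => [g|] // _.
  exists (shift b g^-1%g), m; rewrite /norm proj_coloring_shift; split=> //.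
  split=> // [|k]; first by rewrite shiftE bm /= mulgV.
  by rewrite dom_pcomp; apply: min_m.
have norm_dom b m : norm b m -> m \in dom b by case=> _ bm _; rewrite inE bm.
have norm_uniq a b m k i : norm a m -> norm b k -> i \in dom a -> i \in dom b ->
    a = b /\ m = k.
  move=> na nb ia ib; have [aB am am_min] := na; have [bB bk bk_min] := nb.
  have [g eq_ab] := same_block a b i aB bB ia ib.
  have eq_dom : dom a = dom b by rewrite eq_ab dom_pcomp.
  have mk : m = k.
    apply/val_inj/anti_leq; rewrite am_min ?eq_dom ?norm_dom //.
    by rewrite bk_min // -eq_dom norm_dom.
  split=> //; rewrite eq_ab (_ : g = 1%g) ?shift1 //.
  by move: am; rewrite eq_ab shiftE mk bk /= => -[]; rewrite mul1g.
pose spec i p := match p with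
  | inl s => z i = Some s
  | inr (m, g) => exists2 b, norm b m & b i = Some g end.
have spec_exists i : exists p : point, spec i p.
  case zi: (z i) => [s|]; first by exists (inl s).
  have : i \notin dom z by rewrite inE zi.
  rewrite dom_z inE negbK => /bigcupP[B BB].
  have /existsP[b /andP[_ /eqP def_B]] := beta_col B BB.
  rewrite def_B block_proj_coloring => ib; rewrite def_B in BB.
  have [a [m [na ab]]] := norm_exists b i BB ib.
  have : i \in dom a by rewrite (proj_coloring_dom ab).
  by rewrite inE; case ai: (a i) => [g|] // _; exists (inr (m, g)), a.
have [f f_spec] := fin_all_exists spec_exists.
pose q : form := [ffun i => f i].
have q_spec i : spec i (q i) by rewrite ffunE.
have q_norm b m i g : norm b m -> b i = Some g -> q i = inr (m, g).
  move=> nb bi; have ib : i \in dom b by rewrite inE bi.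
  have := q_spec i; case: (q i) => [s|[k h]] /=.
    by have [bB _ _] := nb; rewrite (not_zero b i bB ib).
  case=> a na ai; have ia : i \in dom a by rewrite inE ai.
  by have [ab ->] := norm_uniq a b k m i na nb ia ib; move: ai; rewrite ab bi => -[->].
have q_inr i m g : q i = inr (m, g) -> exists2 b, norm b m & b i = Some g.
  by move=> qi; have := q_spec i; rewrite qi.
have fq : is_form q.
  apply/is_formP => i m g /q_inr[b nb bi]; have [_ bm min_m] := nb; split.
    by apply: min_m; rewrite inE bi.
  by apply/eqP; apply: q_norm nb bm.
have q_block b m : norm b m -> form_block q m = b.
  move=> nb; apply/ffunP => i; case bi: (b i) => [g|].
    by apply/eqP/form_blockP; apply: q_norm nb bi.
  case c_i: (form_block q m i) => [g|] //; move/eqP/form_blockP: c_i.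
  case/q_inr => a na ai; rewrite -bi -ai.
  by have [->] := norm_uniq a b m m m na nb (norm_dom _ _ na) (norm_dom _ _ nb).
exists q => //; symmetry; apply: of_form_eq => //; rewrite def_x /=.
  apply/setP => B; apply/idP/form_partsP => [BB|[m rm ->]].
    have /existsP[b /andP[/set0Pn[i ib] /eqP def_B]] := beta_col B BB.
    rewrite def_B in BB *; have [a [m [na <-]]] := norm_exists b i BB ib.
    have [_ am _] := na.
    by exists m; [apply/eqP; apply: q_norm na am | rewrite (q_block a m na)].
  have [b nb _] := q_inr _ _ _ (eqP rm); rewrite (q_block b m nb).
  by have [] := nb.
apply/ffunP => i; rewrite !ffunE -[f i](ffunE f); have := q_spec i.
rewrite ffunE; case: (f i) => [s|[m g]] //= [b nb bi].
by have [bB _ _] := nb; rewrite (not_zero b i bB) // inE bi.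
Qed.

End NormalForms.

(** * Counting along the tower *)

Section Tower.
Variables (n : nat) (gT : finGroupType) (S : finType) (act : gT -> S -> S).
Hypothesis act1 : forall s, act 1%g s = s.
Hypothesis actM : forall g h s, act (g * h)%g s = act g (act h s).

Local Notation point := (S + 'I_n * gT)%type.
Local Notation form := {ffun 'I_n -> point}.
Local Notation D := (dowling n act).
Local Notation pact := (pact act).
Local Notation subst := (subst act).
Local Notation form_le := (form_le act).
Local Notation of_form := (of_form act).
Implicit Types (q v w : form) (p : point) (i k m : 'I_n) (g h : gT) (x y : D).

(** For normal forms, asking for roots gives singletons: the block with minimum [k] only contains
    indices from [k] on, and these are roots too. *)
Definition trivial_from (t : nat) q := [forall k : 'I_n, (t <= k)%N ==> is_root q k].

Lemma trivial_fromP t q :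
  reflect (forall k, (t <= k)%N -> q k = inr (k, 1%g)) (trivial_from t q).
Proof.
by apply: (iffP forall_inP) => H k tk; [apply/eqP/H | apply/eqP/H].
Qed.

Lemma trivial_fromW t t' q : (t <= t')%N -> trivial_from t q -> trivial_from t' q.
Proof.
move=> tt' /trivial_fromP q_t; apply/trivial_fromP => k t'k.
exact/q_t/(leq_trans tt').
Qed.

(** Going up can only color the block of [k] or lower its minimum, so a root of [w] is already a
    root of [v]. *)
Lemma trivial_from_le t v w :
  is_form v -> is_form w -> form_le v w -> trivial_from t w -> trivial_from t v.
Proof.
move=> fv fw /form_leP le_vw /trivial_fromP w_t; apply/trivial_fromP => k tk.
have := le_vw k; rewrite (w_t k tk); case vk: (v k) => [//|[m g]] /=.
case wm: (w m) => [//|[l h]] /= [k_l _]; rewrite -k_l in wm.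
have [mk /eqP rm] := is_formP _ fv k m g vk; have [km _] := is_formP _ fw m k h wm.
have m_k : m = k by apply/val_inj/anti_leq; rewrite mk.
by rewrite -vk -m_k rm.
Qed.

Definition zero_form : form := [ffun k => inr (k, 1%g)].

Lemma zero_form_form : is_form zero_form.
Proof.
by apply/is_formP => k m g; rewrite /is_root !ffunE => -[-> _].
Qed.

Lemma trivial_from0 q : trivial_from 0 q = (q == zero_form).
Proof.
apply/trivial_fromP/eqP => [q0|-> k _]; last by rewrite ffunE.
by apply/ffunP => k; rewrite ffunE q0.
Qed.

Lemma zero_form_le q : form_le zero_form q.
Proof. by apply/form_leP => k; rewrite ffunE /= pact1. Qed.

Lemma of_zero_form : of_form zero_form = dowling_zero n act.
Proof.
have block_i m : form_block zero_form m = singleton_coloring gT m.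
  by apply/ffunP => k; rewrite !ffunE.
apply/esym/of_form_eq; first exact: zero_form_form.
  apply/setP => B; apply/imsetP/form_partsP => -[m _ ->]; exists m; rewrite ?block_i //.
  by rewrite /is_root ffunE.
by apply/ffunP => k; rewrite !ffunE.
Qed.

(** * Detaching and attaching a single index *)

Section Index.
Variable i : 'I_n.

(** Meant for [q] in which all indices above [i] are singletons: no other index then refers to [i]
    ([trivial_no_ref]), and a larger block loses [i] without losing its minimum. *)
Definition reset q : form := [ffun k => if k == i then inr (i, 1%g) else q k].

(** The join of [q] with [atom p]; [p] is first translated by [q], because its index may have
    another root there. *)
Definition attach p q : form := [ffun k => if k == i then subst p q else q k].

Definition atom p : form := attach p zero_form.

Definition atom_ok p : bool := if p is inr (m, _) then (m < i)%N else true.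

Lemma trivial_no_ref q k g :
  is_form q -> trivial_from i.+1 q -> q k = inr (i, g) -> k = i.
Proof.
move=> fq /trivial_fromP q_i qk; have [ik _] := is_formP _ fq k i g qk.
apply/val_inj/anti_leq; rewrite ik andbT leqNgt; apply/negP => lt_ik.
by move: qk; rewrite q_i // => -[k_i]; rewrite k_i ltnn in lt_ik.
Qed.

Lemma reset_form q : is_form q -> trivial_from i.+1 q -> is_form (reset q).
Proof.
move=> fq q_i; apply/is_formP => k m g; rewrite /is_root !ffunE.
case: (eqVneq k i) => [->|ki]; first by case=> <- _; rewrite !eqxx.
move=> qk; have [mk rm] := is_formP _ fq k m g qk; split=> //.
case: (eqVneq m i) => [m_i|//]; rewrite m_i in qk.
by rewrite (trivial_no_ref fq q_i qk) eqxx in ki.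
Qed.

Lemma reset_trivial q : trivial_from i.+1 q -> trivial_from i (reset q).
Proof.
move=> /trivial_fromP q_i; apply/trivial_fromP => k ik; rewrite ffunE.
case: (eqVneq k i) => [->//|ki]; apply: q_i.
by rewrite ltn_neqAle ik andbT eq_sym.
Qed.

Lemma reset_le q : is_form q -> form_le (reset q) q.
Proof.
move=> fq; apply/form_leP => k; rewrite ffunE; case: eqP => [->|_] /=.
  by rewrite pact1.
by rewrite subst_idem.
Qed.

Lemma reset_max v q : is_form v -> trivial_from i v -> form_le v q -> form_le v (reset q).
Proof.
move=> fv v_i /form_leP le_vq; apply/form_leP => k; rewrite ffunE.
case: (eqVneq k i) => [->|ki].
  by rewrite (trivial_fromP _ _ v_i) //= pact1 // ffunE eqxx.
rewrite le_vq; case vk: (v k) => [//|[m g]] /=; rewrite ffunE.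
case: (eqVneq m i) => [m_i|//]; rewrite m_i in vk.
by rewrite (trivial_no_ref fv (trivial_fromW (leqnSn i) v_i) vk) eqxx in ki.
Qed.

Lemma attach_form p v :
  is_form v -> trivial_from i v -> atom_ok p -> is_form (attach p v).
Proof.
move=> fv v_i ok; apply/is_formP => k m g; rewrite /is_root !ffunE.
case: (eqVneq k i) => [->|ki].
  case: p ok => [//|[l h]] /= li; case vl: (v l) => [//|[l' h']] /= [<- _].
  have [l'l rl'] := is_formP _ fv l l' h' vl.
  have l'i := leq_ltn_trans l'l li; split; first exact: ltnW.
  by rewrite ifN //; apply: contraTneq l'i => ->; rewrite ltnn.
move=> vk; have [mk rm] := is_formP _ fv k m g vk; split=> //.
rewrite ifN //; apply: contraNneq ki => m_i; rewrite m_i in vk.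
by rewrite (trivial_no_ref fv (trivial_fromW (leqnSn i) v_i) vk).
Qed.

Lemma attach_trivial p v : trivial_from i v -> trivial_from i.+1 (attach p v).
Proof.
move=> /trivial_fromP v_i; apply/trivial_fromP => k ik; rewrite ffunE ifN.
  exact/v_i/ltnW.
by apply: contraTneq ik => ->; rewrite ltnn.
Qed.

Lemma atomE p : atom p = [ffun k => if k == i then p else inr (k, 1%g)].
Proof.
apply/ffunP => k; rewrite !ffunE; case: eqP => // _.
by case: p => [//|[m h]] /=; rewrite ffunE /= mulg1.
Qed.

Lemma atom_inj : injective atom.
Proof.
by move=> p p' /ffunP/(_ i); rewrite !atomE !ffunE eqxx.
Qed.

Lemma atom_form p : atom_ok p -> is_form (atom p).
Proof.
by apply: attach_form; [apply: zero_form_form | apply/trivial_fromP => k _; rewrite ffunE].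
Qed.

Lemma atom_leE p w : form_le (atom p) w = (w i == subst p w).
Proof.
rewrite atomE; apply/form_leP/eqP => [->|w_i k]; rewrite ffunE ?eqxx //.
by case: eqP => [->//|_] /=; rewrite pact1.
Qed.

(** An admissible [p] refers at most to an index below [i], so changing the value at [i] does not
    affect its translation. *)
Lemma subst_below p v w :
  atom_ok p -> (forall k, (k < i)%N -> v k = w k) -> subst p v = subst p w.
Proof. by case: p => [//|[m g]] /= mi eq_vw; rewrite eq_vw. Qed.

Lemma attach_below p v k : (k < i)%N -> attach p v k = v k.
Proof.
by move=> ki; rewrite ffunE ifN //; apply: contraTneq ki => ->; rewrite ltnn.
Qed.

Lemma reset_below v k : (k < i)%N -> reset v k = v k.
Proof.
by move=> ki; rewrite ffunE ifN //; apply: contraTneq ki => ->; rewrite ltnn.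
Qed.

Lemma attach_ge p v : is_form v -> trivial_from i v -> form_le v (attach p v).
Proof.
move=> fv v_i; apply/form_leP => k; case vk: (v k) => [s|[m g]] /=.
  rewrite ffunE vk; case: eqP => // k_i.
  by move: vk; rewrite k_i (trivial_fromP _ _ v_i).
case: (eqVneq k i) => [k_i|ki].
  move: vk; rewrite k_i (trivial_fromP _ _ v_i) // => -[<- <-].
  by rewrite pact1.
rewrite !ffunE (negbTE ki) ifN; last first.
  apply: contraNneq ki => m_i; rewrite m_i in vk.
  by rewrite (trivial_no_ref fv (trivial_fromW (leqnSn i) v_i) vk).
by rewrite -{1}(subst_idem act k fv) vk.
Qed.

Lemma attach_ge_atom p v : atom_ok p -> form_le (atom p) (attach p v).
Proof.
move=> ok; rewrite atom_leE {1}/attach ffunE eqxx; apply/eqP/subst_below => // k ki.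
by rewrite attach_below.
Qed.

Lemma reset_attach p v : trivial_from i v -> reset (attach p v) = v.
Proof.
move=> v_i; apply/ffunP => k; rewrite !ffunE; case: eqP => [->|//].
by rewrite (trivial_fromP _ _ v_i).
Qed.

Lemma attach_lub p v w : is_form w ->
  form_le v w -> form_le (atom p) w -> form_le (attach p v) w.
Proof.
move=> fw /form_leP le_vw; rewrite atom_leE => /eqP w_i; apply/form_leP => k.
rewrite ffunE; case: eqP => [->|_]; last exact: le_vw.
rewrite w_i; case: p {w_i} => [//|[m g]] /=.
by rewrite subst_pact // -le_vw.
Qed.

Lemma attach_reset p w : atom_ok p -> form_le (atom p) w -> attach p (reset w) = w.
Proof.
move=> ok; rewrite atom_leE => /eqP w_i; apply/ffunP => k; rewrite !ffunE.
case: (eqVneq k i) => [->|//]; rewrite [RHS]w_i; apply: subst_below => // l li.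
exact: reset_below.
Qed.

Lemma atom_nontrivial p w :
  is_form w -> atom_ok p -> form_le (atom p) w -> ~~ trivial_from i w.
Proof.
move=> fw ok; rewrite atom_leE => /eqP w_i; apply/negP => /trivial_fromP/(_ i (leqnn i)).
rewrite w_i; case: p ok {w_i} => [//|[m g]] /= mi; case wm: (w m) => [//|[l h]] /= [l_i _].
by have [] := is_formP _ fw m l h wm; rewrite l_i leqNgt mi.
Qed.

Lemma reset_zeroE w : is_form w -> w != zero_form -> reset w = zero_form ->
  exists2 p, atom_ok p & w = atom p.
Proof.
move=> fw w0 rw; have def_w : w = atom (w i).
  apply/ffunP => k; rewrite atomE ffunE; case: eqP => [->//|/eqP ki].
  by have /ffunP/(_ k) := rw; rewrite !ffunE (negbTE ki).
exists (w i) => //; rewrite /atom_ok; case wi: (w i) => [//|[m g]].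
have [mi rm] := is_formP _ fw i m g wi; rewrite ltn_neqAle mi andbT.
apply: contra w0 => /eqP/val_inj m_i; rewrite m_i in rm; apply/eqP/ffunP => k.
by rewrite def_w atomE !ffunE (eqP rm); case: eqP => [->|].
Qed.

Lemma card_atom_ok : #|[set p | atom_ok p]| = (#|S| + #|gT| * i)%N.
Proof.
rewrite -sum1_card big_sumType /=; congr addn.
  by rewrite (eq_bigl xpredT) ?sum1_card // => s; rewrite inE.
rewrite (eq_bigl (fun mg : 'I_n * gT => (mg.1 < i)%N)); last by case=> m g; rewrite inE.
rewrite (eq_bigl (fun mg : 'I_n * gT => (mg.1 < i)%N && true)); last by move=> mg; rewrite andbT.
rewrite -(pair_big_dep (fun m : 'I_n => (m < i)%N) (fun _ _ => true) (fun _ _ => 1%N)) /=.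
under eq_bigr => m _ do rewrite sum1_card.
rewrite sum_nat_const mulnC; congr muln.
rewrite -sum1_card -(big_ord_widen n (fun=> 1%N) (ltnW (ltn_ord i))).
by rewrite sum1_card card_ord.
Qed.

End Index.

(** * Transfer to the elements of the Dowling poset *)

Fact to_form_subproof :
  {f : D -> form | forall x, is_form (f x) & forall x, of_form (f x) = x}.
Proof.
have ex_form x : exists q, is_form q && (of_form q == x).
  by have [q fq <-] := of_form_onto x; exists q; rewrite fq eqxx.
exists (fun x => xchoose (ex_form x)) => x; have /andP[] := xchooseP (ex_form x) => //.
by move=> _ /eqP.
Qed.

(* The opacity of [to_form_subproof] keeps unification from computing [to_form]. *)
Definition to_form : D -> form := s2val to_form_subproof.

Lemma to_form_form x : is_form (to_form x).
Proof. exact: s2valP to_form_subproof x. Qed.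

Lemma to_formK : cancel to_form of_form.
Proof. exact: s2valP' to_form_subproof. Qed.

Lemma of_formK q : is_form q -> to_form (of_form q) = q.
Proof. by move=> fq; apply: (@of_form_inj _ _ _ act); rewrite ?to_formK //; apply: to_form_form. Qed.

Lemma to_form_le x y : form_le (to_form x) (to_form y) = (x <= y)%O.
Proof.
by rewrite -(of_form_le act1 actM (to_form_form x) (to_form_form y)) !to_formK.
Qed.

Local Notation o := (dowling_zero n act).

Lemma to_form0 : to_form o = zero_form.
Proof. by rewrite -of_zero_form of_formK // zero_form_form. Qed.

Lemma dowling_ge0 x : (o <= x)%O.
Proof. by rewrite -to_form_le to_form0; apply: zero_form_le. Qed.

Definition level (t : nat) x := trivial_from t (to_form x).

Lemma level_le t x y : (x <= y)%O -> level t y -> level t x.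
Proof. by rewrite -to_form_le => /(trivial_from_le (to_form_form x) (to_form_form y)); apply. Qed.

Lemma level0 x : level 0 x = (x == o).
Proof.
rewrite /level trivial_from0 -to_form0 (inj_eq (can_inj to_formK)) //.
Qed.

Section Level.
Variables (F : fieldType) (i : 'I_n).

Definition dreset x : D := of_form (reset i (to_form x)).
Definition dattach p x : D := of_form (attach i p (to_form x)).
Definition datom p : D := of_form (atom i p).
(** The first argument is meant to be an atom, whose point is recovered as the value at [i]. *)
Definition djoin x y : D := dattach (to_form x i) y.

Lemma to_form_reset x : level i.+1 x -> to_form (dreset x) = reset i (to_form x).
Proof. by move=> xi; rewrite of_formK // reset_form // to_form_form. Qed.

Lemma to_form_attach p x : atom_ok i p -> level i x ->
  to_form (dattach p x) = attach i p (to_form x).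
Proof. by move=> ok xi; rewrite of_formK // attach_form // to_form_form. Qed.

Lemma to_form_atom p : atom_ok i p -> to_form (datom p) = atom i p.
Proof. by move=> ok; rewrite of_formK // atom_form. Qed.

Lemma level_reset x : level i.+1 x -> level i (dreset x).
Proof. by move=> xi; rewrite /level to_form_reset // reset_trivial. Qed.

Lemma level_attach p x : atom_ok i p -> level i x -> level i.+1 (dattach p x).
Proof. by move=> ok xi; rewrite /level to_form_attach // attach_trivial. Qed.

Lemma dreset_attach p x : atom_ok i p -> level i x -> dreset (dattach p x) = x.
Proof. by move=> ok xi; rewrite /dreset to_form_attach // reset_attach // to_formK. Qed.

Lemma datom_le p x : atom_ok i p -> (datom p <= x)%O = form_le (atom i p) (to_form x).
Proof. by move=> ok; rewrite -to_form_le to_form_atom. Qed.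

Lemma datom_attach p x : atom_ok i p -> level i x -> (datom p <= dattach p x)%O.
Proof. by move=> ok xi; rewrite datom_le // to_form_attach // attach_ge_atom. Qed.

Lemma dattach_reset p x : atom_ok i p -> level i.+1 x -> (datom p <= x)%O ->
  dattach p (dreset x) = x.
Proof.
move=> ok xi; rewrite datom_le // => le_px.
by rewrite /dattach to_form_reset // attach_reset // to_formK.
Qed.

Lemma datom_level p x : atom_ok i p -> (datom p <= x)%O -> ~~ level i x.
Proof. by move=> ok; rewrite datom_le //; apply: atom_nontrivial; rewrite // to_form_form. Qed.

Lemma djoin_atom p x : atom_ok i p -> djoin (datom p) x = dattach p x.
Proof. by move=> ok; rewrite /djoin to_form_atom // atomE ffunE eqxx. Qed.

Lemma dreset0P a : level i.+1 a -> a != o -> dreset a = o ->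
  exists2 p, atom_ok i p & a = datom p.
Proof.
move=> ai a0 ra; have [||p ok qa] := @reset_zeroE i (to_form a) (to_form_form a).
- by rewrite -to_form0 (inj_eq (can_inj to_formK)).
- by rewrite -to_form_reset // ra to_form0.
by exists p; rewrite // /datom -qa to_formK.
Qed.

Lemma dreset_atom p : atom_ok i p -> dreset (datom p) = o.
Proof.
move=> ok; have -> : datom p = dattach p o by rewrite /dattach to_form0.
by rewrite dreset_attach // /level to_form0; apply/trivial_fromP => k _; rewrite ffunE.
Qed.

(** The instance of [interval_dim_modular] with [dreset x] as coatom; its set of complements is
    parametrized by the points [p] through [datom]. *)
Lemma interval_dim_level x d : level i.+1 x -> ~~ level i x ->
    (forall r, r != d -> interval_dim F o (dreset x) r = 0%N) ->
  interval_dim F o x 0 = 0%N /\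
  forall r, interval_dim F o x r.+1 =
    (#|[set p | atom_ok i p && (datom p <= x)%O]| * interval_dim F o (dreset x) r)%N.
Proof.
move=> x_i x_ni conc; pose y := dreset x; have y_i : level i y := level_reset x_i.
have le_x (w : D) : (w <= x)%O -> level i.+1 w by move/level_le; apply.
have le_y (w : D) : (w <= y)%O -> level i w by move/level_le; apply.
have res_le (w : D) : level i.+1 w -> (dreset w <= w)%O.
  by move=> w_i; rewrite -to_form_le to_form_reset // reset_le // to_form_form.
have res_max (w v : D) : level i.+1 w -> level i v -> (v <= w)%O -> (v <= dreset w)%O.
  move=> w_i v_i; rewrite -!to_form_le to_form_reset // => le_vw.
  by apply: reset_max => //; apply: to_form_form.
have lt_yx : (y < x)%O.
  by rewrite lt_neqAle res_le // andbT; apply: contraNneq x_ni => <-.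
pose At := [set a | [&& (a <= x)%O, a != o & dreset a == o]].
have AtP (a : D) : a \in At -> exists p, [/\ atom_ok i p, a = datom p & (datom p <= x)%O].
  rewrite inE => /and3P[ax ao /eqP ra].
  by have [p ok def_a] := dreset0P (le_x a ax) ao ra; exists p; rewrite -def_a.
have lub (a v w : D) : a \in At -> level i v -> (a <= w)%O -> (v <= w)%O -> (djoin a v <= w)%O.
  case/AtP => p [ok -> _] v_i; rewrite djoin_atom // datom_le // => aw.
  by rewrite -!to_form_le to_form_attach // => vw; apply: attach_lub => //; apply: to_form_form.
have -> : #|[set p | atom_ok i p && (datom p <= x)%O]| = #|At|.
  have inj_at : {in atom_ok i &, injective datom}.
    move=> p p' ok ok' eq_pp'; apply: (@atom_inj i).
    by rewrite -(to_form_atom ok) -(to_form_atom ok') eq_pp'.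
  rewrite -(card_in_imset (f := datom)); last first.
    by move=> p p'; rewrite !inE => /andP[ok _] /andP[ok' _]; apply: inj_at.
  congr #|pred_of_set _|; apply/setP => a; apply/imsetP/idP => [[p]|/AtP[p [ok -> px]]].
    rewrite inE => /andP[ok px] ->; rewrite inE px dreset_atom // eqxx andbT /=.
    have := datom_level ok (lexx _); apply: contra => /eqP ->.
    by rewrite /level to_form0; apply/trivial_fromP => k _; rewrite ffunE.
  by exists p; rewrite // inE ok.
apply: (@interval_dim_modular F _ D o x y dreset djoin _ _ _ _ _ _ _ _ d) => //.
- exact: dowling_ge0.
- move=> w wx; have w_i := le_x w wx; rewrite res_le //=.
  by apply: res_max => //; [exact: level_reset | apply: le_trans wx; apply: res_le].
- by move=> w v wx vy vw; apply: res_max => //; [apply: le_x | apply: le_y].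
- move=> a v aAt vy; have v_i := le_y v vy.
  have [p [ok def_a px]] := AtP a aAt.
  have vx : (v <= x)%O := le_trans vy (ltW lt_yx).
  rewrite lub // def_a // djoin_atom // datom_attach //; split=> //.
  by rewrite -to_form_le to_form_attach // attach_ge // to_form_form.
- move=> a v aAt vy; have [p [ok -> _]] := AtP a aAt.
  by rewrite djoin_atom // dreset_attach // le_y.
- by move=> a v w aAt vy wx aw vw; apply: lub => //; apply: le_y.
- move=> a w aAt aw wx; have [p [ok def_a _]] := AtP a aAt.
  by rewrite def_a djoin_atom // dattach_reset ?le_x // -def_a.
Qed.

(** For a fixed atom, [dreset] and [dattach p] are inverse bijections between the two ranges of
    summation. *)
Lemma sum_datom p (f : D -> nat) : atom_ok i p ->
  (\sum_(x : D | [&& (datom p <= x)%O, level i.+1 x & ~~ level i x]) f (dreset x) =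
   \sum_(x : D | level i x) f x)%N.
Proof.
move=> ok; rewrite (reindex_onto (dattach p) dreset); last first.
  by move=> x /and3P[px x_i _]; apply: dattach_reset.
apply: eq_big => [x|x /andP[_ /eqP -> //]].
apply/andP/idP => [[/and3P[_ x_i _] /eqP <-]|x_i]; first exact: level_reset.
have px := datom_attach ok x_i.
by rewrite px level_attach // (datom_level ok px) dreset_attach.
Qed.

Lemma interval_dim_sum_level r :
    (forall x, exists d, forall r, r != d -> interval_dim F o x r = 0%N) ->
  (\sum_(x : D | level i.+1 x && ~~ level i x) interval_dim F o x r.+1 =
    (#|S| + #|gT| * i) * \sum_(x : D | level i x) interval_dim F o x r)%N.
Proof.
move=> conc.
transitivity (\sum_(x : D | level i.+1 x && ~~ level i x)
    \sum_(p | atom_ok i p && (datom p <= x)%O) interval_dim F o (dreset x) r)%N.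
  apply: eq_bigr => x /andP[x_i x_ni]; have [d conc_d] := conc (dreset x).
  by rewrite (proj2 (interval_dim_level x_i x_ni conc_d)) sum_nat_cond_const -cardsE.
(* Once the atom is fixed, the sum over [x] no longer depends on it, by [sum_datom]. *)
rewrite (exchange_big_dep (atom_ok i)) /=; last by move=> x p _ /andP[].
rewrite -(card_atom_ok i) cardsE -sum_nat_const; apply: eq_bigr => p ok.
apply: etrans (sum_datom (fun x => interval_dim F o x r) ok).
by apply: eq_bigl => x; rewrite ok andTb andbC.
Qed.

End Level.

(** The degree rises by one whenever an index is attached; this is the invariant that
    [interval_dim_level] asks of [dreset x]. *)
Lemma interval_dim_concentrated (F : fieldType) x :
  exists d, forall r, r != d -> interval_dim F o x r = 0%N.
Proof.
suff conc t : (t <= n)%N -> forall x, level t x ->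
    exists d, forall r, r != d -> interval_dim F o x r = 0%N.
  by apply: (conc n) => //; apply/trivial_fromP => k; rewrite leqNgt ltn_ord.
elim: t => [_ y|t IHt lt_tn y y_t].
  by rewrite level0 => /eqP ->; exists 0%N => r; rewrite /interval_dim eqxx => /negbTE ->.
have [|y_nt] := boolP (level t y); first by apply: IHt; apply: ltnW.
have [|d conc_d] := IHt (ltnW lt_tn) (dreset (Ordinal lt_tn) y).
  exact: (@level_reset (Ordinal lt_tn)).
have [H0 H] := @interval_dim_level F (Ordinal lt_tn) y d y_t y_nt conc_d.
exists d.+1 => -[_|r rd]; first exact: H0.
by rewrite H conc_d ?muln0.
Qed.

Lemma interval_dim_sum (F : fieldType) (t r : nat) : (t <= n)%N ->
  ((\sum_(x : D | level t x) interval_dim F o x r)%N)%:R =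
    (\prod_(i < t) (1 + (#|S| + #|gT| * i)%:R *: 'X) : {poly int})`_r.
Proof.
elim: t r => [|t IHt] r lt_tn.
  rewrite big_ord0 coef1 (big_pred1 o) => [|x]; last exact: level0.
  by rewrite /interval_dim eqxx; case: (r == 0%N).
have lvl x : level t x -> level t.+1 x by apply: trivial_fromW.
rewrite big_ord_recr /= mulrDr mulr1 coefD -scalerAr coefZ coefMX.
(* The elements already of level [t] account for the 1 in the new factor, the others for its term in
   ['X]. *)
rewrite (bigID (level t)) /= [LHS]natrD; congr (_ + _).
  rewrite -IHt ?(ltnW lt_tn) //; congr (_%:R); apply: eq_bigl => x.
  by case: (boolP (level t x)) => [/lvl ->|]; rewrite ?andbF.
case: r => [|r] /=.
  rewrite mulr0 big1 // => x /andP[x_t x_nt].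
  have [d conc_d] := interval_dim_concentrated F (dreset (Ordinal lt_tn) x).
  by have [-> _] := @interval_dim_level F (Ordinal lt_tn) x d x_t x_nt conc_d.
rewrite (@interval_dim_sum_level F (Ordinal lt_tn)); last exact: interval_dim_concentrated.
by rewrite natrM IHt // ltnW.
Qed.

End Tower.

(** * From interval dimensions to Whitney homology *)

Lemma dim_direct_sum (F : fieldType) (I : finType) (V : I -> vectType F) :
  \dim {: \big[@direct_sum F/zero_space F]_i V i} = (\sum_i \dim {: V i})%N.
Proof.
rewrite dimvf (eq_bigr (fun i => dim (V i))) => [|i _]; last exact: dimvf.
by apply: (big_morph (fun U : vectType F => dim U)).
Qed.

Lemma dim_WH (F : fieldType) (disp : Order.disp_t) (T : finPOrderType disp) (o : T) r :
  \dim {: WH F o r} = (\sum_(x : T) interval_dim F o x r)%N.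
Proof.
rewrite /WH dim_direct_sum; apply: eq_bigr => x _.
rewrite /interval_homology /interval_dim dimvf.
case: (x == o); first by case: (r == 0%N).
by case: r => [//|m]; rewrite -dim_homology.
Qed.

Theorem theorem2p32 (F : fieldType) (n : nat) (gT : finGroupType) (S : finType)
    (act : gT -> S -> S)
    (act1 : forall s, act 1%g s = s)
    (actM : forall g h s, act (g * h)%g s = act g (act h s))
    (n_ge1 : (1 <= n)%N) (S_nonempty : (0 < #|S|)%N) (r : nat) :
  (\dim {: WH F (dowling_zero n act) r})%:R =
    (\prod_(i < n) (1 + (#|S| + #|gT| * i)%:R *: 'X) : {poly int})`_r.
Proof.
rewrite dim_WH -(interval_dim_sum act1 actM F r (leqnn n)); congr (_%:R).
by apply: eq_bigl => x; apply/esym/trivial_fromP => k; rewrite leqNgt ltn_ord.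
Qed.
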